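(* Let $F:\Omega\subset\mathbb R^n\to\mathbb R^n$ ($\Omega$ open) be given by an evaluation procedure, let $x^\ast$ be an isolated root of $F$, and let $\lozenge_{x^\ast}F$ be bijective on a ball $\mathcal D=B(x^\ast,\bar R)\subset\Omega$, with metric regularity constant $c>0$ on $\mathcal D$. Let $\gamma_F$ be a second-order constant valid on $\mathcal D$, let $R=\min(\bar R,\frac1{c\gamma_F})$ and $\rho=\frac R3$. Then: (tangent mode) for every initial point $x_0\in B(x^\ast,\rho)$ the Newton iteration $x_{k+1}=N(x_k)$ converges quadratically towards $x^\ast$; (secant mode) for all initial points $x_0,x_1\in B(x^\ast,\rho)$ the Newton iteration $x_{k+1}=N(x_k,x_{k-1})$ converges with order $\frac{1+\sqrt5}2$ towards $x^\ast$.
   Context: All norms are infinity norms; $B(x,r)$ is the open ball; $\frac1{c\gamma_F}=+\infty$ if $\gamma_F=0$; $0<\bar R<\infty$. Evaluation procedure. $F:\Omega\subset\mathbb R^n\to\mathbb R^m$ (here $m=n$) is evaluated by a finite straight-line program: $v_{1-n},\dots,v_0$ are the components of $x$; for $i=1,\dots,l$ each $v_i$ is either $v_i=v_j+v_k$, or $v_i=|v_j|$, or $v_i=\varphi_i(v_j)$ with indices $j,k<i$, where each smooth univariate elemental $\varphi_i$ is defined on an open subset of $\mathbb R$ containing all values $v_j(x)$, $x\in\Omega$, and is differentiable there with locally Lipschitz derivative; the last $m$ values form $F(x)$. (Multiplications by constants are smooth univariate elementals; subtraction, product and quotient are rewritten using these, $u\cdot w=\tfrac14[(u+w)^2-(u-w)^2]$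 and the reciprocal.) Secant model. For $\check x,\hat x\in\Omega$ put $\check v_i=v_i(\check x)$, $\hat v_i=v_i(\hat x)$, $\mathring v_i=(\check v_i+\hat v_i)/2$, $\mathring x=(\check x+\hat x)/2$. For $\Delta x\in\mathbb R^n$ define increments recursively: for the inputs, $\Delta v_{1-n},\dots,\Delta v_0$ are the components of $\Delta x$; $\Delta v_i=\Delta v_j+\Delta v_k$ if $v_i=v_j+v_k$; $\Delta v_i=c_{ij}\Delta v_j$ if $v_i=\varphi_i(v_j)$, with $c_{ij}=(\check v_i-\hat v_i)/(\check v_j-\hat v_j)$ if $\check v_j\ne\hat v_j$ and $c_{ij}=\varphi_i'(\mathring v_j)$ otherwise; $\Delta v_i=|\mathring v_j+\Delta v_j|-\mathring v_i$ if $v_i=|v_j|$. The vector of the last $m$ increments is $\Delta F(\check x,\hat x;\Delta x)$, and $\lozenge_{\check x}^{\hat x}F(x)=\tfrac12(F(\check x)+F(\hat x))+\Delta F(\check x,\hat x;x-\mathring x)$ for $x\in\mathbb R^n$. Tangent model: $\lozenge_{\mathring x}F=\lozenge_{\mathring x}^{\mathring x}F$. Second-order constant: $\gamma_F$ is valid on a set $U$ if it is obtained, for some convex $K$ with $U\subset K\subset\Omega$, by these recurrences with all quantities finite: $\beta_{x_i}=1,\gamma_{x_i}=0$ for inputs; $\beta_v=\beta_u+\beta_w$, $\gamma_v=\gamma_u+\gamma_w$ if $v=u+w$; $\beta_v=\beta_u$, $\gamma_v=\gamma_u$ if $v=|u|$; $\beta_v=\beta_uL_K(\varphi)$, $\gamma_v=L_K(\varphi)\gamma_u+L_K(\varphi')\beta_u^2$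 if $v=\varphi(u)$, where $L_K(\varphi)=\sup_{x\in K}|\varphi'(u(x))|$ and $L_K(\varphi')$ is the Lipschitz constant of $\varphi'$ on $u(K)$; $\gamma_F$ is the maximum over components. Bijectivity on $\mathcal D$ means that $\lozenge_{x^\ast}F|_{\mathcal D}:\mathcal D\to\lozenge_{x^\ast}F(\mathcal D)$ is a bijection. Metric regularity with constant $c>0$: for all $x\in\mathcal D$, $y\in\lozenge_{x^\ast}F(\mathcal D)$, $\|x-(\lozenge_{x^\ast}F|_{\mathcal D})^{-1}(y)\|\le c\|\lozenge_{x^\ast}F(x)-y\|$. Newton operator: $N(\mathring x)$ is a point of $\arg\min\{\|x-\mathring x\|:\lozenge_{\mathring x}F(x)=0\}$ (tangent mode), $N(\hat x,\check x)$ is a point of $\arg\min\{\|x-\tfrac12(\hat x+\check x)\|:\lozenge_{\check x}^{\hat x}F(x)=0\}$ (secant mode); any minimizer may be chosen. Quadratic convergence: $x_k\to x^\ast$ and $\|x_{k+1}-x^\ast\|\le C\|x_k-x^\ast\|^2$ for some constant $C$ and all $k$. Convergence with order $p>1$: there are $C>0$ and $q\in(0,1)$ with $\|x_k-x^\ast\|\le C\,q^{p^k}$ for all $k$. *)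

(* Defs.v *)
From HB Require Import structures.
From mathcomp Require Import all_boot all_order all_algebra.
From mathcomp Require Import all_classical all_reals all_analysis.

Set Implicit Arguments.
Unset Strict Implicit.
Unset Printing Implicit Defensive.

Import Order.TTheory GRing.Theory Num.Theory.
Import numFieldNormedType.Exports.

Local Open Scope classical_set_scope.
Local Open Scope ring_scope.

(* Smooth univariate elementals. [efun] is total, but only its behaviour on
   the open set [edom] is constrained. *)
Record elemental (R : realType) := Elemental {
  edom : set R;
  efun :> R -> R;
  edom_open : open edom;
  efun_derivable : forall t, edom t -> derivable efun t 1;
  efun_derive_lipschitz : forall t, edom t ->
    exists2 U, nbhs t U & [lipschitz (derive1 efun : R^o -> R^o) s | s in U] }.

(* [instr R k] may only refer to the [k] values computed before it. *)
Inductive instr (R : realType) (k : nat) : Type :=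
  | Sum of 'I_k & 'I_k
  | Abs of 'I_k
  | Elem of elemental R & 'I_k.

(* Values are stored in slots numbered from 0: slots [0 .. n-1] hold the
   inputs (the paper's v_{1-n}, ..., v_0), and instruction [i : 'I_len] fills
   slot [n + i]. The outputs are the last [n] of the [n + len] slots. *)
Record program (R : realType) (n : nat) := Program {
  len : nat;
  ins : forall i : 'I_len, instr R (n + i)%N }.

Section Evaluation.
Context {R : realType} {n : nat} (p : program R n).

Definition trace {T : Type} (init : seq T)
    (step : 'I_(len p) -> seq T -> T) : seq T :=
  foldl (fun vs i => rcons vs (step i vs)) init (enum 'I_(len p)).

Definition inputs (x : 'rV[R]_n) : seq R := [seq x 0 j | j <- enum 'I_n].

Definition outputs (vs : seq R) : 'rV[R]_n := \row_(i < n) vs`_(len p + i)%N.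

Definition values (x : 'rV[R]_n) : seq R :=
  trace (inputs x) (fun i vs =>
    match ins i with
    | Sum j k => vs`_j + vs`_k
    | Abs j => `|vs`_j|
    | Elem phi j => phi vs`_j
    end).

Definition val_at (i : nat) (x : 'rV[R]_n) : R := (values x)`_i.

Definition evaluate (x : 'rV[R]_n) : 'rV[R]_n := outputs (values x).

Definition midpoint (xc xh : 'rV[R]_n) : 'rV[R]_n := 2^-1 *: (xc + xh).

(* [xc] and [xh] are the base points x-check and x-hat. *)
Definition increments (xc xh dx : 'rV[R]_n) : seq R :=
  let vc i := val_at i xc in
  let vh i := val_at i xh in
  let vm i := (vc i + vh i) / 2 in
  trace (inputs dx) (fun i dv =>
    match ins i with
    | Sum j k => dv`_j + dv`_k
    | Abs j => `|vm j + dv`_j| - vm (n + i)%N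
    | Elem phi j =>
        (if vc j == vh j then derive1 phi (vm j)
         else (vc (n + i)%N - vh (n + i)%N) / (vc j - vh j)) * dv`_j
    end).

Definition secant_model (xc xh x : 'rV[R]_n) : 'rV[R]_n :=
  2^-1 *: (evaluate xc + evaluate xh)
  + outputs (increments xc xh (x - midpoint xc xh)).

Definition tangent_model (xm : 'rV[R]_n) : 'rV[R]_n -> 'rV[R]_n :=
  secant_model xm xm.

(* L_K(phi) for the elemental phi applied to the intermediate value u. *)
Definition sup_derive (K : set 'rV[R]_n) (phi : R -> R) (u : 'rV[R]_n -> R)
    : \bar R :=
  ereal_sup [set `|derive1 phi (u x)|%:E | x in K].

(* L_K(phi'): the least Lipschitz constant of phi' on u(K), +oo if there is
   none. *)
Definition lip_derive (K : set 'rV[R]_n) (phi : R -> R) (u : 'rV[R]_n -> R)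
    : \bar R :=
  ereal_inf [set k%:E | k in
    [set k : R | 0 <= k /\ k.-lipschitz_(u @` K) (derive1 phi : R^o -> R^o)]].

(* The pairs (beta_v, gamma_v). The conversions [fine] are meaningful only
   under [finite_constants]. *)
Definition bounds (K : set 'rV[R]_n) : seq (R * R) :=
  trace (nseq n (1, 0)) (fun i bs =>
    let beta j := (nth (0, 0) bs j).1 in
    let gamma j := (nth (0, 0) bs j).2 in
    match ins i with
    | Sum j k => (beta j + beta k, gamma j + gamma k)
    | Abs j => (beta j, gamma j)
    | Elem phi j =>
        let L := fine (sup_derive K phi (val_at j)) in
        let L' := fine (lip_derive K phi (val_at j)) in
        (beta j * L, L * gamma j + L' * beta j ^+ 2)
    end).

Definition finite_constants (K : set 'rV[R]_n) : Prop :=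
  forall (i : 'I_(len p)) phi j, ins i = Elem phi j ->
    (sup_derive K phi (val_at j) \is a fin_num) /\
    (lip_derive K phi (val_at j) \is a fin_num).

End Evaluation.

Record evaluation_procedure (R : realType) (n : nat) (Omega : set 'rV[R]_n) :=
  EvaluationProcedure {
    code :> program R n;
    code_defined : forall (i : 'I_(len code)) phi j, ins i = Elem phi j ->
      forall x, Omega x -> edom phi (val_at code j x) }.

Section Newton.
Context {R : realType} {n : nat} {Omega : set 'rV[R]_n}.
Variable F : evaluation_procedure Omega.

Definition second_order_constant (U : set 'rV[R]_n) (gammaF : R) : Prop :=
  exists K : set 'rV[R]_n,
    [/\ convex_set K, U `<=` K, K `<=` Omega, finite_constants F K &
        gammaF = \big[Num.max/0]_(i < n)
                   (nth (0, 0) (bounds F K) (len F + i)%N).2].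

Definition metric_regularity (xstar : 'rV[R]_n) (D : set 'rV[R]_n) (c : R)
    : Prop :=
  let G := tangent_model F xstar in
  forall x y, D x -> (G @` D) y ->
    `|x - 'pinv_(fun=> 0) D G y| <= c * `|G x - y|.

Definition nearest_roots (G : 'rV[R]_n -> 'rV[R]_n) (a : 'rV[R]_n)
    : set 'rV[R]_n :=
  [set x | G x = 0 /\ forall y, G y = 0 -> `|x - a| <= `|y - a|].

(* The admissible values of N(xm) and N(xh, xc). The models are only defined
   for base points in Omega, so there is no admissible value otherwise. *)
Definition newton_tangent (xm : 'rV[R]_n) : set 'rV[R]_n :=
  [set x | Omega xm /\ nearest_roots (tangent_model F xm) xm x].

Definition newton_secant (xh xc : 'rV[R]_n) : set 'rV[R]_n :=
  [set x | [/\ Omega xh, Omega xc &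
               nearest_roots (secant_model F xc xh) (midpoint xh xc) x]].

(* A run follows the iteration, with arbitrary choices of minimizers, for as
   long as the Newton operator is defined; it is unconstrained afterwards. That
   the iteration never breaks down is thus something to be proved about runs,
   and not part of their definition. *)
Definition tangent_run (x : nat -> 'rV[R]_n) : Prop :=
  forall k, newton_tangent (x k) !=set0 -> newton_tangent (x k) (x k.+1).

Definition secant_run (x : nat -> 'rV[R]_n) : Prop :=
  forall k, newton_secant (x k.+1) (x k) !=set0 ->
            newton_secant (x k.+1) (x k) (x k.+2).

End Newton.

Definition newton_radius (R : realType) (Rbar c gammaF : R) : R :=
  if gammaF == 0 then Rbar else Num.min Rbar (c * gammaF)^-1.

Definition converges_quadratically (R : realType) (n : nat)
    (x : nat -> 'rV[R]_n) (xstar : 'rV[R]_n) : Prop :=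
  x @ \oo --> xstar /\
  exists C : R, forall k, `|x k.+1 - xstar| <= C * `|x k - xstar| ^+ 2.

Definition converges_with_order (R : realType) (n : nat) (r : R)
    (x : nat -> 'rV[R]_n) (xstar : 'rV[R]_n) : Prop :=
  exists C q : R, [/\ 0 < C, 0 < q < 1 &
    forall k : nat, `|x k - xstar| <= C * q `^ (r ^+ k)].

(* Main.v *)
Require Import Defs.
From HB Require Import structures.
From mathcomp Require Import all_boot all_order all_algebra all_fingroup.
From mathcomp Require Import all_classical all_reals all_analysis.
From mathcomp Require Import zify ring lra.

Set Implicit Arguments.
Unset Strict Implicit.
Unset Printing Implicit Defensive.

Import Order.TTheory GRing.Theory Num.Theory.
Import numFieldNormedType.Exports.

Local Open Scope ring_scope.

(* Let e1, e2 be the distances of the two base points to the root, e the larger of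
   them, and d the distance of a root of the secant model to the root of F. The secant model and the tangent
   model at the root differ by at most gamma * (e1 * e2 + e * d), so metric
   regularity gives d <= c * gamma * (e1 * e2 + e * d), which for e < rho yields
   2 * rho * d <= e1 * e2; both convergence orders follow.
   The secant model may have singular pieces, so that it has a root near the root
   of F is a topological fact: the tangent model at the root is expansive (its
   inverse is c-Lipschitz), hence maps a ball onto a neighbourhood of 0 of the
   expected size (invariance of domain), and Brouwer's theorem applies to
   secant model o inverse of the tangent model. Brouwer's theorem is obtained by
   counting, modulo 2, the fully labelled simplices of the Freudenthal-Kuhn
   triangulation: their parity depends only on the labels on the boundary. Balls
   are cubes because the norm is the sup norm.
   Invariance of domain for an expansive f: let G be a Lipschitz left inverse of f.
   If y were missed by f, push the image of f away from y onto a sphere around y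
   containing f(0) in its inside; G minus a small vector outside of the G-image of
   the sphere then has no zero on the pushed image, against Brouwer. *)

(** * Parity of the number of fully labelled simplices *)

(** The involution pairs off the elements of [A]; the induction removes one pair at a time. *)
Lemma odd_card_involution (T : finType) (A : {set T}) (f : T -> T) :
  involutive f -> {in A, forall x, f x \in A} -> {in A, forall x, f x != x} ->
  ~~ odd #|A|.
Proof.
move=> fK; have [k] := ubnP #|A|; elim: k => // k IHk in A * => leAk fA fx.
have [->|[x xA]] := set_0Vmem A; first by rewrite cards0.
have fxA : f x \in A :\ x by rewrite !inE fx ?fA.
move: leAk; rewrite (cardsD1 x) xA (cardsD1 (f x)) fxA /= negbK => leAk.
apply: IHk => [|y|y]; first by lia.
- rewrite !inE => /and3P[yfx yx yA]; rewrite fA // andbT.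
  by rewrite (inj_eq (inv_inj fK)) yx /=; apply: contra yfx => /eqP <-; rewrite fK.
- by rewrite !inE => /and3P[_ _ /fx].
Qed.

Section FullyLabelledSimplex.

(** The doors of Sperner's argument: the facet opposite to vertex [k] carries every label except the
    last. *)
Definition facet_labelled n (c : 'I_n.+1 -> 'I_n.+1) (k : 'I_n.+1) :=
  [forall l, (l != ord_max) ==> [exists m, (m != k) && (c m == l)]].

(** A fully labelled simplex has one door, opposite to its last label. Any other simplex has none or
    two: the vertices of a door carry pairwise distinct labels, so the omitted vertex repeats
    exactly one of them, and either of the two equally labelled vertices may be omitted. *)
Lemma odd_facets_labelled n (c : 'I_n.+1 -> 'I_n.+1) :
  odd #|[set k | facet_labelled c k]| = injectiveb c.
Proof.
have [/injectiveP c_inj|] := boolP (injectiveb c).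
  have [d cK dK] := injF_bij c_inj.
  suff -> : [set k | facet_labelled c k] = [set d ord_max] by rewrite cards1.
  apply/setP=> k; rewrite !inE; apply/forallP/eqP => [ck|-> l].
    have := ck (c k); case: (eqVneq (c k) ord_max) => [<-|_]; first by rewrite cK.
    by move=> /existsP[m /andP[mk /eqP /c_inj /eqP]]; rewrite (negbTE mk).
  apply/implyP => lmax; apply/existsP; exists (d l); rewrite dK eqxx andbT.
  by rewrite (can_eq dK).
move=> c_ninj; apply/negbTE.
have [->|[k0]] := set_0Vmem [set k | facet_labelled c k]; first by rewrite cards0.
rewrite inE => /forallP gk0.
have imc : [set: 'I_n.+1] :\ ord_max \subset c @: ([set: 'I_n.+1] :\ k0).
  apply/fintype.subsetP => l; rewrite !inE andbT => lmax.
  have := gk0 l; rewrite lmax => /existsP[m /andP[mk0 /eqP <-]].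
  by apply: imset_f; rewrite !inE mk0.
have card1 (k : 'I_n.+1) : #|[set: 'I_n.+1] :\ k| = n.
  by have := cardsD1 k [set: 'I_n.+1]; rewrite inE cardsT card_ord => -[].
have c_inj : {in [set: 'I_n.+1] :\ k0 &, injective c}.
  apply/imset_injP; rewrite eqn_leq leq_imset_card.
  by rewrite card1 (leq_trans _ (subset_leq_card imc)) ?card1.
have imcE : c @: ([set: 'I_n.+1] :\ k0) = [set: 'I_n.+1] :\ ord_max.
  apply/esym/eqP; rewrite eqEcard imc card1.
  by rewrite (leq_trans (leq_imset_card _ _)) ?card1.
(* If [k0] had the last label, [c] would be injective; so its label also occurs at another vertex
   [k1]. *)
have [k1 k10 ck1] : exists2 k1, k1 != k0 & c k1 = c k0.
  have [k0max|k0max] := eqVneq (c k0) ord_max.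
    case/injectiveP: c_ninj => x y cxy.
    have out k : k != k0 -> c k != ord_max.
      move=> kk0; have : c k \in c @: ([set: 'I_n.+1] :\ k0).
        by apply: imset_f; rewrite !inE kk0.
      by rewrite imcE !inE andbT.
    have [xk0|xk0] := eqVneq x k0; have [yk0|yk0] := eqVneq y k0.
    - by rewrite xk0.
    - by have := out _ yk0; rewrite -cxy xk0 k0max eqxx.
    - by have := out _ xk0; rewrite cxy yk0 k0max eqxx.
    - by apply: c_inj => //; rewrite !inE ?xk0 ?yk0.
  have : c k0 \in c @: ([set: 'I_n.+1] :\ k0) by rewrite imcE !inE k0max.
  by case/imsetP=> k1; rewrite !inE andbT => k10 ck; exists k1.
suff -> : [set k | facet_labelled c k] = [set k0; k1] by rewrite cards2 eq_sym k10.
apply/setP => k; rewrite !inE; apply/idP/orP => [/forallP gk|[|]/eqP->]; last 2 first.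
- exact/forallP.
- apply/forallP => l; apply/implyP => lmax.
  have := gk0 l; rewrite lmax => /existsP[m /andP[mk0 /eqP cm]].
  apply/existsP; have [mk1|mk1] := eqVneq m k1; last by exists m; rewrite mk1 cm /=.
  by exists k0; rewrite eq_sym k10 -ck1 -mk1 cm /=.
have [->|kk0] := eqVneq k k0; [by left|right; apply/eqP].
have ckmax : c k != ord_max.
  have : c k \in c @: ([set: 'I_n.+1] :\ k0) by apply: imset_f; rewrite !inE kk0.
  by rewrite imcE !inE andbT.
have := gk (c k); rewrite ckmax => /existsP[m /andP[mk /eqP cm]].
have [mk0|mk0] := eqVneq m k0.
  by apply: c_inj; rewrite ?inE ?kk0 ?k10 // -cm mk0.
by have : m = k; [apply: c_inj; rewrite ?inE ?kk0 ?mk0|move/eqP; rewrite (negbTE mk)].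
Qed.

(* Freudenthal-Kuhn triangulation of the cube [0, N+1]^n: vertex [k] of the
   simplex [(a, s)] is reached from the corner [a] of a unit cell by increasing
   the [k] coordinates of rank less than [k], [s j] being the rank of [j]. *)
Variables (N n' : nat).
Local Notation n := n'.+1.
Implicit Types (a : {ffun 'I_n -> 'I_N.+1}) (s : 'S_n) (v : {ffun 'I_n -> nat}).

Definition vertex a s (k : nat) : {ffun 'I_n -> nat} :=
  [ffun j => (a j + (s j < k))%N].

Local Notation facet := ({ffun 'I_n -> 'I_N.+1} * 'S_n * 'I_n.+1)%type.

(** Cyclic shifts of the ranks: once vertex 0 is dropped, the coordinate of rank 0 is raised last
    and the other ranks decrease by one. *)
Definition rank_pred : 'S_n := perm (@ord_pred_inj n).
Definition rank_succ : 'S_n := perm (@ordS_inj n).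

(* The facet [(a, s, k)] omits vertex [k] of [(a, s)]; [pivot] goes to the other
   simplex that contains this facet. That simplex is taken modulo
   N+1 in every coordinate, which makes [pivot] a total involution. *)
Definition pivot (t : facet) : facet :=
  let: (a, s, k) := t in
  if k == ord0 then
    ([ffun j => if s j == ord0 then ordS (a j) else a j],
      (s * rank_pred)%g, ord_max)
  else if k == ord_max then
    ([ffun j => if s j == ord_max then ord_pred (a j) else a j],
      (s * rank_succ)%g, ord0)
  else (a, (s * tperm (inord k.-1) (inord k))%g, k).

(** The facets on the boundary of the cube, where passing to the neighbour wraps around modulo
    N+1. *)
Definition wraps (t : facet) : bool :=
  let: (a, s, k) := t in
  (k == ord0) && [exists j, (s j == ord0) && (a j == ord_max)] ||
  (k == ord_max) && [exists j, (s j == ord_max) && (a j == ord0)].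

Lemma ord_pred_eq_max m (i : 'I_m.+1) : (ord_pred i == ord_max) = (i == ord0).
Proof.
have -> : ord_max = ord_pred ord0 :> 'I_m.+1.
  by apply/val_inj; rewrite /= modn_small.
by rewrite (inj_eq (@ord_pred_inj _)).
Qed.

Lemma ordS_eq0 m (i : 'I_m.+1) : (ordS i == ord0) = (i == ord_max).
Proof.
have -> : ord0 = ordS ord_max :> 'I_m.+1 by apply/val_inj; rewrite /= modnn.
by rewrite (inj_eq (@ordS_inj _)).
Qed.

Lemma ord_pred_val m (i : 'I_m.+1) : i != ord0 -> ord_pred i = i.-1 :> nat.
Proof.
case: i => -[|i] ilt //= _.
by rewrite modnDr modn_small // ltnW.
Qed.

Lemma ordS_val m (i : 'I_m.+1) : i != ord_max -> ordS i = i.+1 :> nat.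
Proof.
move=> imax /=; rewrite modn_small // ltnS ltn_neqAle -ltnS ltn_ord andbT.
by apply: contra imax => /eqP ?; apply/eqP/val_inj.
Qed.

Lemma rank_predS s : (s * rank_pred * rank_succ)%g = s.
Proof. by apply/permP => j; rewrite !permM !permE ord_predK. Qed.

Lemma rank_succP s : (s * rank_succ * rank_pred)%g = s.
Proof. by apply/permP => j; rewrite !permM !permE ordSK. Qed.

Lemma pivotK : involutive pivot.
Proof.
move=> [[a s] k] /=; have [->|k0] := eqVneq k ord0 => /=.
  rewrite eqxx rank_predS; congr (_, _, _); apply/ffunP => j; rewrite !ffunE permM permE.
  by rewrite ord_pred_eq_max; case: eqP => // _; rewrite ordSK.
have [->|kmax] := eqVneq k ord_max => /=.
  rewrite rank_succP; congr (_, _, _); apply/ffunP => j; rewrite !ffunE permM permE.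
  by rewrite ordS_eq0; case: eqP => // _; rewrite ord_predK.
by rewrite (negbTE k0) (negbTE kmax) -mulgA tperm2 mulg1.
Qed.

Lemma pivot_neq t : pivot t != t.
Proof.
case: t => [[a s] k] /=; have [->|k0] := eqVneq k ord0 => /=.
  by apply/eqP => -[_ _].
have [->|kmax] := eqVneq k ord_max => /=; first by apply/eqP => -[_ _].
apply/eqP => -[/(congr1 (mulg s^-1)%g)]; rewrite mulKg mulVg => /permP/(_ (inord k)).
rewrite tpermR perm1 => /(congr1 val) /=.
have k_gt0 : (0 < k)%N by rewrite lt0n.
have ltkn : (k < n)%N.
  rewrite ltn_neqAle -ltnS ltn_ord andbT.
  by apply: contra kmax => /eqP ?; apply/eqP/val_inj.
by rewrite !inordK; lia.
Qed.

Lemma wraps_pivot t : wraps (pivot t) = wraps t.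
Proof.
case: t => [[a s] k] /=; have [->|k0] := eqVneq k ord0 => /=.
  rewrite ?eqxx ?orbF /=; apply: eq_existsb => j; rewrite permM permE ord_pred_eq_max.
  by rewrite !ffunE; case: eqP => //= _; rewrite ordS_eq0.
have [_|kmax] := eqVneq k ord_max => /=.
  rewrite ?orbF /=; apply: eq_existsb => j; rewrite permM permE ordS_eq0.
  by rewrite !ffunE; case: eqP => //= _; rewrite ord_pred_eq_max.
by rewrite ?(negbTE k0) ?(negbTE kmax).
Qed.

(** The common vertices keep their order in the neighbour: their numbers decrease by one if vertex 0
    is omitted, increase by one if the last is, and stay the same otherwise. *)
Lemma pivot_vertex a s k (m : 'I_n.+1) : ~~ wraps (a, s, k) -> m != k ->
  exists2 m' : 'I_n.+1, m' != (pivot (a, s, k)).2 &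
    vertex (pivot (a, s, k)).1.1 (pivot (a, s, k)).1.2 m' = vertex a s m.
Proof.
rewrite /wraps /pivot; have [->|k0] := eqVneq k ord0 => /=.
  rewrite orbF => /existsPn nwrap m0.
  exists (ord_pred m); rewrite ?ord_pred_eq_max //.
  apply/ffunP => j; rewrite !ffunE permM permE (ord_pred_val m0).
  have m_gt0 : (0 < m)%N by rewrite lt0n.
  have [sj0|sj0] := eqVneq (s j) ord0.
    have := nwrap j; rewrite sj0 eqxx /= => /ordS_val /= ->.
    rewrite modn_small //=; have := ltn_ord m; lia.
  rewrite (ord_pred_val sj0); have : (0 < s j)%N by rewrite lt0n.
  lia.
have [->|kmax] := eqVneq k ord_max => /=.
  move=> /existsPn nwrap mmax.
  exists (ordS m); rewrite ?ordS_eq0 //.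
  apply/ffunP => j; rewrite !ffunE permM permE (ordS_val mmax).
  have ltmn : (m < n)%N.
    rewrite ltn_neqAle -ltnS ltn_ord andbT.
    by apply: contra mmax => /eqP ?; apply/eqP/val_inj.
  have [sj0|sj0] := eqVneq (s j) ord_max.
    have := nwrap j; rewrite sj0 eqxx /= => aj0.
    have : (0 < a j)%N by rewrite lt0n.
    have /= -> := ord_pred_val aj0; rewrite modnn; lia.
  by rewrite (ordS_val sj0).
(* The ranks k-1 and k are exchanged, and only the omitted vertex [k] tells them apart. *)
move=> _ mk; exists m => //; apply/ffunP => j; rewrite !ffunE permM.
have k_gt0 : (0 < k)%N by rewrite lt0n.
have ltkn : (k < n)%N.
  rewrite ltn_neqAle -ltnS ltn_ord andbT.
  by apply: contra kmax => /eqP ?; apply/eqP/val_inj.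
have mkN : (m : nat) <> k by move=> /val_inj/eqP; rewrite (negbTE mk).
case: tpermP => [->|->|//]; rewrite !inordK; lia.
Qed.

Definition labels (c : {ffun 'I_n -> nat} -> 'I_n.+1) a s (k : 'I_n.+1) :=
  c (vertex a s k).

(** Double counting of doors modulo 2: summed over simplices they give the fully labelled ones,
    while [pivot] pairs off the doors in the interior and leaves those on the boundary. *)
Lemma odd_simplices_labelled c :
  odd #|[set t : _ * 'S_n | injectiveb (labels c t.1 t.2)]| =
  odd #|[set t : facet | wraps t && facet_labelled (labels c t.1.1 t.1.2) t.2]|.
Proof.
pose A := [set t : facet | facet_labelled (labels c t.1.1 t.1.2) t.2].
transitivity (odd #|A|); last first.
  rewrite -(cardsID [set t | wraps t] A) oddD.
  rewrite [X in _ (+) X](_ : _ = false) ?addbF.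
    by congr (odd #|finset.pred_of_set _|); apply/setP => t; rewrite !inE andbC.
  apply/negbTE/odd_card_involution => [|t|t _].
  - exact: pivotK.
  - rewrite !inE wraps_pivot => /andP[tN tg]; rewrite tN /=.
    case: t => [[a s] k] in tN tg *; apply/forallP => l; apply/implyP => lmax.
    move/forallP/(_ l): tg; rewrite lmax /= => /existsP[m /andP[mk /eqP <-]].
    have [m' m'k Em] := pivot_vertex tN mk.
    by apply/existsP; exists m'; rewrite m'k /labels Em eqxx.
  - exact: pivot_neq.
have -> : #|A| = (\sum_(t : {ffun 'I_n -> 'I_N.+1} * 'S_n)
    #|[set k | facet_labelled (labels c t.1 t.2) k]|)%N.
  rewrite -sum1_card; under [RHS]eq_bigr do rewrite -sum1_card.
  by rewrite pair_big_dep /=; apply: eq_bigl => -[t k]; rewrite !inE.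
rewrite -sum1_card big_mkcond /=.
rewrite !(big_morph odd oddD (erefl _)) /=; apply: eq_bigr => t _.
by rewrite odd_facets_labelled inE; case: ifP.
Qed.

(** Equal to n, the last label, when no coordinate satisfies [P]. *)
Definition first_index (P : pred 'I_n) : 'I_n.+1 := inord (find P (enum 'I_n)).

Lemma first_index_val (P : pred 'I_n) :
  first_index P = find P (enum 'I_n) :> nat.
Proof. by rewrite inordK // ltnS -[X in (_ <= X)%N](size_enum_ord n) find_size. Qed.

Lemma first_indexP (P : pred 'I_n) (j : 'I_n) :
  first_index P = j :> nat -> P j.
Proof.
rewrite first_index_val => Ej.
have := @nth_find _ j P (enum 'I_n); rewrite has_find Ej size_enum_ord ltn_ord.
by rewrite nth_ord_enum; exact.
Qed.

Lemma first_indexN (P : pred 'I_n) (j : 'I_n) :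
  (j < first_index P)%N -> P j = false.
Proof.
by rewrite first_index_val => /(before_find j); rewrite nth_ord_enum.
Qed.

Lemma first_index_le (P Q : pred 'I_n) :
  (forall j, Q j -> P j) -> (first_index P <= first_index Q)%N.
Proof.
move=> QP; rewrite leqNgt; apply/negP => lt.
have ltn' : (first_index Q < n)%N by rewrite (leq_trans lt) // -ltnS ltn_ord.
have Qj := @first_indexP Q (Ordinal ltn') (erefl _).
by have := @first_indexN P (Ordinal ltn') lt; rewrite QP.
Qed.

Lemma first_index_eq (P : pred 'I_n) (m : 'I_n.+1) :
  (forall j : 'I_n, (j < m)%N -> ~~ P j) -> (forall j : 'I_n, j = m :> nat -> P j) ->
  first_index P = m.
Proof.
move=> ltm Pm; apply/val_inj/eqP; rewrite eqn_leq /=; apply/andP; split.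
  rewrite leqNgt; apply/negP => lt.
  have ltmn : (m < n)%N by rewrite (leq_trans lt) // -ltnS ltn_ord.
  by have := @first_indexN P (Ordinal ltmn) lt; rewrite Pm.
rewrite leqNgt; apply/negP => lt.
have ltmn : (first_index P < n)%N by rewrite (leq_trans lt) // -ltnS ltn_ord.
have := @first_indexP P (Ordinal ltmn) (erefl _).
exact/negP/ltm.
Qed.

(** Strict monotonicity gives i <= c i by counting up from 0 and c i <= i by counting down from
    m. *)
Lemma inj_monotone_ord m (c : 'I_m.+1 -> 'I_m.+1) : injective c ->
  (forall i j : 'I_m.+1, (i <= j)%N -> (c i <= c j)%N) -> c =1 id.
Proof.
move=> c_inj c_mono.
have lt_c (i j : 'I_m.+1) : (i < j)%N -> (c i < c j)%N.
  move=> lt; rewrite ltn_neqAle c_mono 1?ltnW // andbT.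
  by apply/eqP => /val_inj/c_inj E; rewrite E ltnn in lt.
have ge (i : 'I_m.+1) : (i <= c i)%N.
  case: i => i; elim: i => // i IHi lti.
  have lti' : (i < m.+1)%N by apply: ltn_trans lti.
  by apply: leq_ltn_trans (IHi lti') _; apply: lt_c.
have le k : forall i : 'I_m.+1, (i + k = m)%N -> (c i <= i)%N.
  elim: k => [i|k IHk i] E; first by rewrite addn0 in E; rewrite E -ltnS.
  have lti : (i.+1 < m.+1)%N by lia.
  have := IHk (Ordinal lti); rewrite /= => /(_ ltac:(lia)).
  have := @lt_c i (Ordinal lti) (ltnSn _); lia.
move=> i; apply/val_inj/eqP; rewrite eqn_leq ge andbT.
by apply: (le (m - i)%N); have := ltn_ord i; lia.
Qed.

(** The reference labelling, whose count is odd. Coordinates only grow along a simplex, hence so do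
    labels, and a fully labelled simplex has label m at vertex m. Its first m coordinates are then
    at least h there and the next one is below h, which forces the corner (h-1, ..., h-1) and the
    identity ranks. *)
Lemma card_simplices_threshold h : (0 < h <= N.+1)%N ->
  #|[set t : _ * 'S_n | injectiveb
      (labels (fun v => first_index (fun j => (v j < h)%N)) t.1 t.2)]| = 1.
Proof.
move=> /andP[h0 hN]; have lth : (h.-1 < N.+1)%N by lia.
apply/eqP/cards1P; exists ([ffun=> Ordinal lth], 1%g); apply/setP => -[a s].
rewrite !inE /=; apply/injectiveP/eqP => [c_inj|[-> ->]]; last first.
  apply: (can_inj (g := id)) => m; apply: first_index_eq => j; rewrite !ffunE perm1 /=.
    by move=> ->; lia.
  by move=> ->; rewrite ltnn; lia.
have cE : labels (fun v => first_index (fun j => (v j < h)%N)) a s =1 id.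
  apply: inj_monotone_ord => // i j leij; apply: first_index_le => l.
  by rewrite !ffunE; case: (ltnP (s l) i); case: (ltnP (s l) j); lia.
have lt_m (j : 'I_n) (m : 'I_n.+1) : (j < m)%N -> (h <= a j + (s j < m))%N.
  move=> ltjm; have := @first_indexN (fun j => (vertex a s m j < h)%N) j.
  have := cE m; rewrite /labels => ->; rewrite ltjm ffunE => /(_ isT)/negbT.
  by rewrite -leqNgt.
have eq_m (j : 'I_n) : (a j + (s j < j) < h)%N.
  have := @first_indexP (fun k => (vertex a s j k < h)%N) j.
  have ltj : (j < n.+1)%N by rewrite ltnS ltnW.
  have := cE (Ordinal ltj); rewrite /labels /= => -> /(_ (erefl _)).
  by rewrite ffunE.
congr (_, _).
  apply/ffunP => j; rewrite ffunE; apply/val_inj => /=.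
  have := lt_m j ord_max (ltn_ord j); have := eq_m j.
  by rewrite /= (ltn_ord (s j)); case: (s j < j)%N; lia.
apply/permP => j; rewrite perm1; apply/val_inj/eqP; rewrite eqn_leq /=.
have := eq_m j; have ltj : (j.+1 < n.+1)%N by rewrite ltnS.
have := lt_m j (Ordinal ltj) (ltnSn _); rewrite /= ltnS.
by case: (ltngtP (s j) j); lia.
Qed.

(** On the boundary the labels agree with the threshold labelling, so the parity is odd and a fully
    labelled simplex exists. [v] is its vertex with the last label, [u j] the one with label j. *)
Lemma exists_labelled_cell (P : {ffun 'I_n -> nat} -> pred 'I_n) h :
  (0 < h <= N.+1)%N ->
  (forall v, [exists j, (v j == 0) || (v j == N.+1)] ->
     forall j, P v j = (v j < h)%N) ->
  exists (a : {ffun 'I_n -> 'I_N.+1}) (v : {ffun 'I_n -> nat})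
      (u : 'I_n -> {ffun 'I_n -> nat}),
    [/\ forall i, (a i <= v i <= (a i).+1)%N,
        forall j i, (a i <= u j i <= (a i).+1)%N,
        forall j, ~~ P v j & forall j, P (u j) j].
Proof.
move=> hN Pbd.
pose c v := first_index (P v).
have odd_c : odd #|[set t : _ * 'S_n | injectiveb (labels c t.1 t.2)]|.
  apply: (eq_trans _ (congr1 odd (card_simplices_threshold hN))).
  rewrite !odd_simplices_labelled; congr (odd #|finset.pred_of_set _|).
  apply/setP => -[[a s] k]; rewrite !inE.
  have [/= w|//] := boolP (wraps _); rewrite /facet_labelled.
  apply: eq_forallb => l; congr (_ ==> _); apply: eq_existsb => m.
  have [//|mk] := eqVneq m k; rewrite /= /labels.
  suff bd : [exists j, (vertex a s m j == 0) || (vertex a s m j == N.+1)].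
    by rewrite /c; congr (first_index _ == _); apply/funext; exact: Pbd.
  (* The vertices of such a facet have a coordinate equal to N+1 if vertex 0 is omitted, and to 0 if
     the last vertex is. *)
  case/orP: w => /andP[/eqP Ek /existsP[j /andP[/eqP sj /eqP aj]]].
    apply/existsP; exists j; rewrite ffunE sj aj.
    have -> : (0 < m)%N.
      by rewrite lt0n; apply: contra mk => /eqP E; apply/eqP/val_inj; rewrite Ek.
    by rewrite /= addn1 eqxx.
  apply/existsP; exists j; rewrite ffunE sj aj /=.
  suff -> : (n' < m)%N = false by [].
  apply/negbTE; rewrite -leqNgt -ltnS ltn_neqAle -ltnS ltn_ord andbT.
  by apply: contra mk => /eqP E; apply/eqP/val_inj; rewrite Ek.
have : [set t : _ * 'S_n | injectiveb (labels c t.1 t.2)] != finset.set0.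
  by apply: contraTneq odd_c => ->; rewrite cards0.
case/set0Pn => -[a s]; rewrite inE => /injectiveP c_inj.
have [d cK dK] := injF_bij c_inj.
have bd i k : (a i <= vertex a s k i <= (a i).+1)%N.
  by rewrite ffunE leq_addr -[(a i).+1]addn1 leq_add2l leq_b1.
exists a, (vertex a s (d ord_max)), (fun j => vertex a s (d (inord j))).
split=> // j.
  have := dK ord_max; rewrite /labels /c => /(congr1 val) /= E.
  by apply/negbT; apply: first_indexN; rewrite E.
have := dK (inord j); rewrite /labels /c => /(congr1 val) /= E.
by apply: first_indexP; rewrite E inordK // ltnS ltnW.
Qed.

End FullyLabelledSimplex.

Local Open Scope classical_set_scope.

(** * Brouwer's fixed point theorem *)

Section RowVectors.
Context {R : realType} {n : nat}.
Implicit Types (x : 'rV[R]_n) (r : R).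

Lemma norm_coord_le x j : `|x 0 j| <= `|x|.
Proof.
by rewrite [leRHS]/Num.Def.normr /= mx_normrE; apply/bigmax_geP; right; exists (0, j).
Qed.

Lemma rV_norm_le x r : 0 <= r -> (forall j, `|x 0 j| <= r) -> `|x| <= r.
Proof.
move=> r0 xr; rewrite [leLHS]/Num.Def.normr /= mx_normrE; apply/bigmax_leP; split => //.
by move=> [i j] _; rewrite /= ord1.
Qed.

Lemma compact_norm_le r : compact [set x : 'rV[R]_n | `|x| <= r].
Proof.
apply: (@bounded_closed_compact R n); last first.
  have -> : [set x : 'rV[R]_n | `|x| <= r] = closed_ball_ Num.norm 0 r.
    by apply/seteqP; split=> x; rewrite /closed_ball_ /= sub0r normrN.
  exact: closed_closed_ball_.
exists r; split; first exact: num_real.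
by move=> M rM x /= /le_trans; apply; exact: ltW.
Qed.

Lemma bounded_sequence_cluster (u : nat -> 'rV[R]_n) r : (forall k, `|u k| <= r) ->
  exists2 x, `|x| <= r &
    forall e, 0 < e -> forall K, exists2 k, (K <= k)%N & `|u k - x| < e.
Proof.
move=> ur; have [|x /= [xr clx]] := @compact_norm_le r (u @ \oo) _.
  by exists 0%N => // k _; exact: ur.
exists x => // e e0 K.
have uK : (u @ \oo) (u @` [set k | (K <= k)%N]).
  by exists K => // k Kk; exists k.
have [_ [[k Kk <-]]] := clx _ _ uK (nbhsx_ballx x e e0).
by rewrite -ball_normE /= distrC => xk; exists k.
Qed.

End RowVectors.

(** Label grid points by the first negative coordinate of [g]; near the boundary [g] is the
    identity, so these are threshold labels. Ever finer grids give points [x k] where no coordinate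
    is negative, with points [u k j] nearby where coordinate j is; a cluster point is a zero. *)
Lemma continuous_zero (R : realType) (n : nat) (g : 'rV[R]_n -> 'rV[R]_n) (r : R) :
  0 < r -> continuous g -> (forall x, r <= `|x| -> g x = x) -> exists x, g x = 0.
Proof.
case: n g => [|n] g r0 g_cont gE; first by exists 0; apply/rowP => -[].
have [x [u xr [ux gx gu]]] : exists x : nat -> 'rV[R]_n.+1,
  exists2 u : nat -> 'I_n.+1 -> 'rV[R]_n.+1, forall k, `|x k| <= r &
  [/\ forall k j, `|u k j - x k| <= r / k.+1%:R,
      forall k j, 0 <= g (x k) 0 j & forall k j, g (u k j) 0 j < 0].
  pose pt h (v : {ffun 'I_n.+1 -> nat}) : 'rV[R]_n.+1 :=
    \row_j (r * ((v j)%:R / h.+1%:R - 1)).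
  have /choice[xu xuP] : forall k, exists xu : 'rV[R]_n.+1 * ('I_n.+1 -> 'rV[R]_n.+1),
      [/\ `|xu.1| <= r, forall j, `|xu.2 j - xu.1| <= r / k.+1%:R,
          forall j, 0 <= g xu.1 0 j & forall j, g (xu.2 j) 0 j < 0].
    move=> k; have k0 : (0 : R) < k.+1%:R by [].
    (* There are 2(k+1) grid steps across [-r, r], and the threshold k+1 is the coordinate 0. *)
    have [||a [v [u [va ua Pv Pu]]]] := @exists_labelled_cell (k.+1 + k)%N n
      (fun v j => g (pt k v) 0 j < 0) k.+1.
    - by lia.
    - move=> v /existsP[i vi] j; rewrite gE.
        by rewrite mxE pmulr_rlt0 // subr_lt0 ltr_pdivrMr // mul1r ltr_nat.
      apply: le_trans (norm_coord_le _ i); rewrite mxE normrM gtr0_norm //.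
      rewrite ler_peMr // ?(ltW r0) //; case/orP: vi => /eqP ->.
        by rewrite mul0r sub0r normrN normr1.
      have -> : (k.+1 + k).+1 = (k.+1 * 2)%N by lia.
      by rewrite natrM mulrC mulKf ?gt_eqF // [2%:R](_ : _ = 1 + 1) // addrK normr1.
    exists (pt k v, fun j => pt k (u j)); split=> /= [|j|j|//].
    - apply: rV_norm_le => [|j]; first exact: ltW.
      rewrite mxE normrM gtr0_norm // ler_piMr ?(ltW r0) // ler_norml.
      rewrite lerBrDr addNr lerBlDr divr_ge0 ?ler0n //= ler_pdivrMr //.
      rewrite -[1 + 1]/(2%:R) -natrM ler_nat; have := va j; have := ltn_ord (a j); lia.
    - apply: rV_norm_le => [|i]; first by rewrite divr_ge0 ?(ltW r0).
      rewrite !mxE -mulrBr normrM gtr0_norm // ler_pM2l //.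
      rewrite [_ - _](_ : _ = ((u j i)%:R - (v i)%:R) / k.+1%:R); last by ring.
      rewrite normrM [`|_^-1|]gtr0_norm ?invr_gt0 // ler_piMl ?invr_ge0 ?ler0n //.
      have := va i; have := ua j i; set A := nat_of_ord _.
      move=> /andP[A1 A2] /andP[A3 A4]; move: A1 A2 A3 A4.
      rewrite -!(ler_nat R) -!natr1 => *; rewrite ler_norml; lra.
    - by rewrite leNgt Pv.
  exists (fun k => (xu k).1), (fun k => (xu k).2) => [k|]; first by case: (xuP k).
  by split=> k; case: (xuP k).
have [y yr clu] := bounded_sequence_cluster xr.
exists y; apply/rowP => j; rewrite mxE; apply/eqP; apply: contraT => gy0.
have gj_cont : {for y, continuous (fun z => g z 0 j)}.
  apply: (@continuous_comp _ _ _ g (fun z => z 0 j)); first exact: g_cont.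
  exact: coord_continuous.
(* A nonzero coordinate keeps its sign near [y]: a negative one contradicts the points [x k], a
   positive one the points [u k j]. *)
have [gyneg|gypos] : g y 0 j < 0 \/ 0 < g y 0 j by case: ltgtP gy0; auto.
  have /nbhs_normP[e /= e0 ye] : \forall z \near y, g z 0 j < 0.
    by apply: (cvgr_lt (g y 0 j) gj_cont).
  have [k _ xky] := clu _ e0 0.
  by have := ye (x k); rewrite /ball_ /= distrC => /(_ xky); rewrite ltNge gx.
have /nbhs_normP[e /= e0 ye] : \forall z \near y, 0 < g z 0 j.
  by apply: (cvgr_gt (g y 0 j) gj_cont).
have e20 : 0 < e / 2 by rewrite divr_gt0.
have [K rK] : exists K, r / (e / 2) < K%:R.
  exists (Num.truncn (r / (e / 2))).+1; exact: truncnS_gt.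
have [k Kk xky] := clu _ e20 K.
suff uky : `|u k j - y| < e.
  by have := ye (u k j); rewrite /ball_ /= distrC => /(_ uky); rewrite ltNge ltW ?gu.
have -> : u k j - y = (u k j - x k) + (x k - y) by rewrite addrA subrK.
rewrite (le_lt_trans (ler_normD _ _)) // [e]splitr ler_ltD // (le_trans (ux k j)) //.
rewrite ler_pdivrMr // mulrC -ler_pdivrMr // (le_trans (ltW rK)) // ler_nat.
exact: leqW.
Qed.

(* Brouwer's fixed point theorem for [x - g x] on the closed ball, which is a
   cube for the sup norm. *)
Lemma continuous_zero_in_ball (R : realType) (n : nat) (g : 'rV[R]_n -> 'rV[R]_n) (r : R) :
  0 < r -> continuous g -> (forall x : 'rV[R]_n, `|x| <= r -> `|g x - x| <= r) ->
  exists2 x : 'rV[R]_n, `|x| <= r & g x = 0.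
Proof.
move=> r0 g_cont gr.
(* [pr] retracts radially onto the ball; [th] is a cutoff, 1 on the ball and 0 from radius 2r on.
   They turn [g] into a map that is the identity far away. *)
pose pr (x : 'rV[R]_n) : 'rV[R]_n := (r / Num.max `|x| r) *: x.
pose th (x : 'rV[R]_n) : R := Num.max 0 (2 - Num.max `|x| r / r).
have max0 (x : 'rV[R]_n) : 0 < Num.max `|x| r by rewrite lt_max r0 orbT.
have max_cont : continuous (fun x : 'rV[R]_n => Num.max `|x| r).
  move=> x; have := @continuous_max R _ (fun x : 'rV[R]_n => `|x|) (fun=> r) x.
  by apply; [exact: norm_continuous|exact: cst_continuous].
have pr_cont : continuous pr.
  move=> x; apply: (@continuousZ _ _ _ (fun x => r / Num.max `|x| r) id).
    apply: (@continuousM _ _ (fun=> r) (fun x : 'rV[R]_n => (Num.max `|x| r)^-1)).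
      exact: cst_continuous.
    by apply: continuousV; [rewrite gt_eqF|exact: max_cont].
  exact: cvg_id.
have th_cont : continuous th.
  move=> x; have := @continuous_max R _ (fun=> 0)
    (fun x : 'rV[R]_n => 2 - Num.max `|x| r / r) x; apply.
    exact: cst_continuous.
  apply: (@continuousB R R^o _ (fun=> 2) (fun x : 'rV[R]_n => Num.max `|x| r / r)).
    exact: cst_continuous.
  apply: (@continuousM _ _ (fun x : 'rV[R]_n => Num.max `|x| r) (fun=> r^-1)).
    exact: max_cont.
  exact: cst_continuous.
have pr_le x : `|pr x| <= r.
  rewrite normrZ normrM normfV (gtr0_norm r0) (gtr0_norm (max0 x)).
  rewrite -mulrA ler_piMr ?(ltW r0) // mulrC ler_pdivrMr // mul1r.
  by rewrite le_max lexx.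
have r2 : 0 < 2 * r by rewrite mulr_gt0.
have [|x xr|x] := @continuous_zero R n (fun x => x - th x *: (pr x - g (pr x))) (2 * r) r2.
- move=> x; apply: (@continuousB _ _ _ id (fun x => th x *: (pr x - g (pr x)))).
    exact: cvg_id.
  apply: (@continuousZ _ _ _ th (fun x => pr x - g (pr x))); first exact: th_cont.
  apply: (@continuousB _ _ _ pr (g \o pr)); first exact: pr_cont.
  by apply: (@continuous_comp _ _ _ pr g); [exact: pr_cont|exact: g_cont].
- rewrite /th (_ : Num.max 0 _ = 0) ?scale0r ?subr0 //; apply/max_idPl.
  rewrite subr_le0 ler_pdivlMr // (le_trans xr) //; by rewrite le_max lexx.
(* The zero [x] is at most as long as pr x - g (pr x), hence in the ball, where [pr] and [th] have
   no effect. *)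
move/eqP; rewrite subr_eq0 => /eqP Ex.
have th_le1 y : 0 <= th y <= 1.
  rewrite /th le_max lexx ge_max ler01 /= lerBlDr.
  rewrite -[2%:R]/(1 + 1 : R) lerD2l ler_pdivlMr // mul1r.
  by rewrite le_max lexx orbT.
have xr : `|x| <= r.
  rewrite Ex normrZ; have /andP[t0 t1] := th_le1 x.
  rewrite ger0_norm // -[r]mul1r ler_pM //.
  by rewrite distrC gr // pr_le.
exists x => //; have Em : Num.max `|x| r = r by apply/max_idPr.
have Epr : pr x = x by rewrite /pr Em divff ?gt_eqF // scale1r.
have Eth : th x = 1.
  by rewrite /th Em divff ?gt_eqF // [2%:R](_ : _ = 1 + 1 :> R) // addrK; apply/max_idPr.
move: Ex; rewrite Epr Eth scale1r => /eqP.
by rewrite -subr_eq0 opprB addrC subrK => /eqP.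
Qed.

(** * Invariance of domain for expansive maps *)

Lemma lipschitz_continuous (R : realType) (V W : normedModType R) (G : V -> W) (c : R) :
  (forall x y, `|G x - G y| <= c * `|x - y|) -> continuous G.
Proof.
move=> GL x; apply/(@cvgrPdist_lt _ _ _ (nbhs x)) => e e0.
have c1 : 0 < `|c| + 1 by rewrite ltr_pwDr.
have ec : 0 < e / (`|c| + 1) by rewrite divr_gt0.
apply: filterS (nbhsx_ballx x _ ec) => y; rewrite -ball_normE /= => xy.
rewrite (le_lt_trans (GL x y)) // (@le_lt_trans _ _ ((`|c| + 1) * `|x - y|)) //.
  by rewrite ler_wpM2r // (le_trans (ler_norm c)) // lerDl.
by rewrite mulrC -ltr_pdivlMr.
Qed.

Section LipschitzLeftInverse.
Context {R : realType} {n : nat}.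
Implicit Types (f G : 'rV[R]_n -> 'rV[R]_n) (c r : R) (x y : 'rV[R]_n).

(* The McShane extension, coordinate by coordinate, of the inverse of [f]. *)
Lemma lipschitz_left_inverse f c r : 0 <= c -> 0 <= r ->
  (forall x y, `|x| <= r -> `|y| <= r -> `|x - y| <= c * `|f x - f y|) ->
  exists2 G, (forall x y, `|G x - G y| <= c * `|x - y|) &
    (forall x, `|x| <= r -> G (f x) = x).
Proof.
move=> c0 r0 fc.
(* The infimum of [S j y] is the extension of coordinate j; with the sup norm, extending coordinates
   separately keeps the constant [c]. *)
pose S (j : 'I_n) y : set R :=
  [set t | exists2 x : 'rV[R]_n, `|x| <= r & t = x 0 j + c * `|y - f x|].
have S0 j y : S j y !=set0.
  by exists ((0 : 'rV[R]_n) 0 j + c * `|y - f 0|), 0; rewrite ?normr0.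
have lbS j y : has_lbound (S j y).
  exists (- r) => _ [x xr ->]; rewrite -[- r]addr0 lerD ?mulr_ge0 //.
  by have := le_trans (norm_coord_le x j) xr; rewrite ler_norml => /andP[].
have infL j y y' : inf (S j y) - inf (S j y') <= c * `|y - y'|.
  rewrite lerBlDr -lerBlDl; apply: lb_le_inf => // _ [x xr ->].
  have Sx : S j y (x 0 j + c * `|y - f x|) by exists x.
  rewrite lerBlDl (le_trans (ge_inf (lbS j y) Sx)) //.
  rewrite addrCA lerD2l -mulrDr ler_wpM2l //.
  by rewrite (le_trans _ (ler_normD _ _)) // addrA subrK.
exists (fun y => \row_j inf (S j y)) => [y y'|x xr].
  apply: rV_norm_le => [|j]; first by rewrite mulr_ge0.
  by rewrite !mxE ler_norml lerNl opprB infL andbT distrC infL.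
apply/rowP => j; rewrite mxE; apply/eqP; rewrite eq_le; apply/andP; split.
  by apply: ge_inf => //; exists x => //; rewrite subrr normr0 mulr0 addr0.
apply: lb_le_inf => // _ [z zr ->].
rewrite -lerBlDl (le_trans _ (fc _ _ xr zr)) // (le_trans _ (norm_coord_le _ j)) //.
by rewrite !mxE ler_norm.
Qed.

End LipschitzLeftInverse.

Lemma truncn_eq_dist (R : archiRealFieldType) (a b : R) : 0 <= a -> 0 <= b ->
  Num.truncn a = Num.truncn b -> `|a - b| <= 1.
Proof.
move=> a0 b0 E; have := truncn_itv a0; have := truncn_itv b0.
rewrite E -natr1 => /andP[bl bu] /andP[al au].
by rewrite ler_norml; apply/andP; split; lra.
Qed.

(* A Lipschitz image of an (n-1)-dimensional sphere has no interior: cut the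
   sphere into cells; there are fewer of them than points in a fine enough
   grid of values. *)
Lemma lipschitz_sphere_image (R : realType) (n : nat)
    (G : 'rV[R]_n.+1 -> 'rV[R]_n.+1) (c e eta : R) (p : 'rV[R]_n.+1) :
  0 <= c -> 0 < e -> 0 < eta -> (forall x y, `|G x - G y| <= c * `|x - y|) ->
  exists2 w, `|w| <= eta & forall y, `|y - p| = e -> G y != w.
Proof.
move=> c0 e0 eta0 GL; apply: contrapT => noW.
have /choice[Y YP] : forall w, exists y, `|w| <= eta -> `|y - p| = e /\ G y = w.
  move=> w; have [we|we] := boolP (`|w| <= eta); last by exists 0.
  apply: contrapT => noY; apply: noW; exists w => // y yp.
  by apply/eqP => Gy; apply: noY; exists y.
(* The grid has [M] values per axis, 2 eta/M apart. Cells have side 2 e/P, so their images have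
   diameter at most 2 c e/P < 2 eta/M. There are at most 2 (n+1) (P+1)^n <= 2 (n+1) (A+1)^n M^n
   cells, fewer than the M^(n+1) grid values. *)
pose A := (Num.truncn (c * e / eta)).+1.
have ltA : c * e / eta < A%:R by exact: truncnS_gt.
pose M := (n.+1 * 2 * A.+1 ^ n).+1.
pose P := (A * M)%N.
pose W (k : {ffun 'I_n.+1 -> 'I_M}) : 'rV[R]_n.+1 :=
  \row_j (eta * (2 * (k j)%:R / M%:R - 1)).
have M0 : (0 : R) < M%:R by rewrite ltr0n.
have P0 : (0 : R) < P%:R by rewrite ltr0n.
have W_le k : `|W k| <= eta.
  apply: rV_norm_le => [|j]; first exact: ltW.
  rewrite mxE normrM gtr0_norm // ler_piMr ?(ltW eta0) // ler_norml.
  rewrite lerBrDr addNr lerBlDr divr_ge0 ?mulr_ge0 //= ler_pdivrMr //.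
  by rewrite -[1 + 1]/(2%:R) ler_pM2l // ler_nat ltnW.
have W_sep k k' : k != k' -> 2 * eta / M%:R <= `|W k - W k'|.
  move=> kk'; have [j kj] : exists j, k j != k' j.
    by apply/existsP; apply: contraR kk' => /existsPn kk'; apply/eqP/ffunP => j;
      apply/eqP; have := kk' j; rewrite negbK.
  apply: le_trans (norm_coord_le _ j); rewrite !mxE -mulrBr normrM (gtr0_norm eta0).
  rewrite [X in eta * `|X|](_ : _ = ((k j)%:R - (k' j)%:R) * (2 / M%:R)); last by ring.
  rewrite normrM [`|2 / _|]gtr0_norm ?divr_gt0 //.
  rewrite [leLHS](_ : _ = eta * (1 * (2 / M%:R))); last by ring.
  rewrite ler_pM2l // ler_pM2r ?divr_gt0 //.
  have := kj; rewrite -val_eqE /= neq_ltn => /orP[] lt.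
    by rewrite distrC ger0_norm ?subr_ge0 ?ler_nat 1?ltnW // lerBrDr addrC natr1 ler_nat.
  by rewrite ger0_norm ?subr_ge0 ?ler_nat 1?ltnW // lerBrDr addrC natr1 ler_nat.
(* In the sup norm the sphere is the surface of a cube, so each of its points lies on a face. *)
have face k : exists j, `|(Y (W k) - p) 0 j| = e.
  have [Ye _] := YP _ (W_le k); apply: contrapT => noj.
  suff : `|Y (W k) - p| < e by rewrite Ye ltxx.
  rewrite [ltLHS]/Num.Def.normr /= mx_normrE; apply/bigmax_ltP; split => // -[i j] _.
  rewrite /= ord1 lt_neqAle; apply/andP; split.
    by apply/eqP => E; apply: noj; exists j.
  by rewrite (le_trans (norm_coord_le _ j)) // Ye.
have /choice[fc fcP] := face.
pose pos k i := ((Y (W k) - p) 0 i + e) / (2 * e) * P%:R.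
have e20 : 0 < 2 * e by rewrite mulr_gt0.
have pos_itv k i : 0 <= pos k i <= P%:R.
  have [Ye _] := YP _ (W_le k).
  have := norm_coord_le (Y (W k) - p) i; rewrite Ye ler_norml => /andP[l u].
  rewrite /pos mulr_ge0 ?divr_ge0 ?(ltW e20) //=; last by rewrite -lerBlDr sub0r.
  by rewrite ler_piMl ?ler0n // ler_pdivrMr // mul1r mulr2n mulrDl !mul1r lerD2r.
(* The face, given by a coordinate and a sign, and the rounded positions in the other [n]
   coordinates; position [P] itself can occur, hence P+1 values. *)
pose cell k : 'I_n.+1 * bool * {ffun 'I_n -> 'I_P.+1} :=
  (fc k, 0 < (Y (W k) - p) 0 (fc k),
   [ffun i => inord (Num.truncn (pos k (lift (fc k) i)))]).
have cell_inj : injective cell.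
  move=> k k' Ecell; apply/eqP; apply: contraT => kk'.
  suff : `|W k - W k'| < 2 * eta / M%:R by rewrite ltNge W_sep.
  have [Yk GYk] := YP _ (W_le k); have [Yk' GYk'] := YP _ (W_le k').
  rewrite -[in ltLHS]GYk -[in ltLHS]GYk' (le_lt_trans (GL _ _)) //.
  case: Ecell => Efc Esg Epos.
  apply: (@le_lt_trans _ _ (c * (2 * e / P%:R))); last first.
    rewrite [ltLHS](_ : _ = c * e / A%:R * (2 / M%:R)); last first.
      by rewrite /P natrM invfM; ring.
    rewrite [ltRHS](_ : _ = eta * (2 / M%:R)); last by ring.
    rewrite ltr_pM2r ?divr_gt0 // ltr_pdivrMr ?ltr0n //.
    by rewrite [ltRHS]mulrC -ltr_pdivrMr.
  rewrite ler_wpM2l //; apply: rV_norm_le => [|i].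
    by rewrite divr_ge0 ?(ltW e20) ?ltW.
  rewrite [X in `|X|](_ : _ = (Y (W k) - p) 0 i - (Y (W k') - p) 0 i); last first.
    by rewrite !mxE; ring.
  case: (unliftP (fc k) i) => [l ->|->]; last first.
    have Ek := fcP k; have := fcP k'; rewrite -Efc => Ek'.
    move: Esg; rewrite -Efc => Esg.
    suff -> : (Y (W k) - p) 0 (fc k) = (Y (W k') - p) 0 (fc k).
      by rewrite subrr normr0 divr_ge0 ?(ltW e20) ?ltW.
    move: Ek Ek' Esg; case: (ltP 0 ((Y (W k) - p) 0 (fc k))) => s1;
      case: (ltP 0 ((Y (W k') - p) 0 (fc k))) => s2 //.
      by rewrite !gtr0_norm // => -> ->.
    by rewrite !ler0_norm // => E1 E2 _; apply: oppr_inj; rewrite E1.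
  move/ffunP/(_ l): Epos; rewrite !ffunE -Efc => /(congr1 val) /=.
  have trP q : (Num.truncn (pos q (lift (fc k) l)) < P.+1)%N.
    have /andP[q0 qP] := pos_itv q (lift (fc k) l).
    by rewrite ltnS -(ler_nat R) (le_trans _ qP) // truncn_le.
  rewrite !inordK // => /truncn_eq_dist.
  move=> /(_ (proj1 (andP (pos_itv _ _))) (proj1 (andP (pos_itv _ _)))).
  rewrite /pos -mulrBl -mulrBl opprD addrACA subrr addr0 !normrM.
  rewrite (gtr0_norm P0) normfV (gtr0_norm e20).
  by rewrite mulrAC ler_pdivrMr // mul1r ler_pdivlMr.
have := leq_card cell cell_inj.
rewrite !card_prod !card_ffun !card_ord card_bool leqNgt => /negP[].
apply: (@leq_ltn_trans (n.+1 * 2 * (A.+1 * M) ^ n)%N).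
  rewrite leq_mul2l /=; have : (P.+1 <= A.+1 * M)%N by rewrite /P mulSn; lia.
  by case: (n) => // n'; rewrite leq_exp2r.
by rewrite expnMn mulnA expnS ltn_mul2r expn_gt0 /= ltnSn.
Qed.

(** Invariance of domain with an explicit radius: c * |y| < r leaves room for a sphere around [y]
    that encloses f 0 = 0 and whose radius e still satisfies c * e < r. *)
Lemma ball_sub_image (R : realType) (n : nat) (f : 'rV[R]_n -> 'rV[R]_n) (c r : R) :
  0 < c -> 0 < r -> continuous f -> f 0 = 0 ->
  (forall x y, `|x| <= r -> `|y| <= r -> `|x - y| <= c * `|f x - f y|) ->
  forall y, c * `|y| < r -> exists2 x, `|x| <= r & f x = y.
Proof.
move=> c0 r0 f_cont f0 fc y yr.
case: n f f_cont f0 fc y yr => [|n] f f_cont f0 fc y yr.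
  by exists 0; [rewrite normr0 ltW|apply/rowP => -[]].
apply: contrapT => noX.
have [G GL GK] := lipschitz_left_inverse (ltW c0) (ltW r0) fc.
have fy_cont : continuous (fun x => `|f x - y|).
  move=> x; apply: (@continuous_comp _ _ _ (fun x : 'rV[R]_n.+1 => f x - y) Num.norm).
    by apply: (@continuousB _ _ _ f (fun=> y)); [exact: f_cont|exact: cst_continuous].
  exact: norm_continuous.
have [tau tau0 ftau] : exists2 tau : R, 0 < tau & forall x, `|x| <= r -> tau <= `|f x - y|.
  have [|||x xr xmin] := @EVT_min_rV R n.+1 (fun x => `|f x - y|) [set x | `|x| <= r].
  - by exists 0; rewrite /= normr0 ltW.
  - exact: compact_norm_le.
  - exact: continuous_subspaceT.
  - exists `|f x - y|; last by move=> z zr; apply: xmin; rewrite inE.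
    rewrite normr_gt0 subr_eq0; apply/eqP => fx; apply: noX; exists x => //.
    by rewrite inE in xr.
pose e := (`|y| + r / c) / 2.
have yrc : `|y| < r / c by rewrite ltr_pdivlMr // mulrC.
have ye : `|y| < e by rewrite /e; lra.
have er : c * e < r by rewrite mulrC -ltr_pdivlMr // /e; lra.
have e0 : 0 < e by exact: le_lt_trans ye.
(* [Phi] pushes points closer than [e] to [y] radially onto the sphere and fixes the others. The
   maximum with [tau] keeps it continuous at [y] and changes nothing on the image of the ball. *)
pose k (z : 'rV[R]_n.+1) : R := Num.max 1 (e * (Num.max `|z - y| tau)^-1).
pose Phi (z : 'rV[R]_n.+1) : 'rV[R]_n.+1 := y + k z *: (z - y).
have max0 (z : 'rV[R]_n.+1) : 0 < Num.max `|z - y| tau by rewrite lt_max tau0 orbT.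
have sub_cont : continuous (fun z : 'rV[R]_n.+1 => z - y).
  move=> z; apply: (@continuousB _ _ _ id (fun=> y)); first exact: cvg_id.
  exact: cst_continuous.
have k_cont : continuous k.
  move=> z; have := @continuous_max R _ (fun=> 1)
    (fun z : 'rV[R]_n.+1 => e * (Num.max `|z - y| tau)^-1) z; apply.
    exact: cst_continuous.
  apply: (@continuousM _ _ (fun=> e) (fun z : 'rV[R]_n.+1 => (Num.max `|z - y| tau)^-1)).
    exact: cst_continuous.
  apply: continuousV; first by rewrite gt_eqF.
  have := @continuous_max R _ (fun z : 'rV[R]_n.+1 => `|z - y|) (fun=> tau) z; apply.
    apply: (@continuous_comp _ _ _ (fun z : 'rV[R]_n.+1 => z - y) Num.norm).
      exact: sub_cont.
    exact: norm_continuous.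
  exact: cst_continuous.
have Phi_cont : continuous Phi.
  move=> z; apply: (@continuousD _ _ _ (fun=> y) (fun z : 'rV[R]_n.+1 => k z *: (z - y))).
    exact: cst_continuous.
  apply: (@continuousZ _ _ _ k (fun z : 'rV[R]_n.+1 => z - y)); first exact: k_cont.
  exact: sub_cont.
have k_far z : tau <= `|z - y| -> e <= `|z - y| -> k z = 1.
  move=> tz ez; rewrite /k (max_idPl tz); apply/max_idPl.
  by rewrite ler_pdivrMr ?mul1r // (lt_le_trans tau0).
have k_near z : tau <= `|z - y| -> `|z - y| < e -> k z * `|z - y| = e.
  move=> tz ez; have z0 := lt_le_trans tau0 tz.
  rewrite /k (max_idPl tz) (max_idPr _) ?divfK ?gt_eqF //.
  by rewrite ler_pdivlMr // mul1r ltW.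
have [mu mu0 fmu] : exists2 mu : R, 0 < mu & forall x, `|x| < mu -> `|f x - y| < e.
  have /nbhs_normP[mu /= mu0 fmu] : \forall x \near (0 : 'rV[R]_n.+1), `|f x - y| < e.
    by apply: (cvgr_lt `|f 0 - y| (fy_cont 0)); rewrite f0 sub0r normrN.
  by exists mu => // x xmu; apply: fmu; rewrite /ball_ /= sub0r normrN.
(* The first bound puts [w] where [f] stays inside the sphere; the second leaves room for [w] in
   Brouwer's estimate. *)
pose eta := Num.min (mu / 2) (r - c * e).
have eta0 : 0 < eta by rewrite lt_min divr_gt0 //= subr_gt0.
have [w w_le Gw] := lipschitz_sphere_image y (ltW c0) e0 eta0 GL.
have [||x xr] := @continuous_zero_in_ball R n.+1 (fun x => G (Phi (f x)) - w) r r0.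
- move=> x; apply: (@continuousB _ _ _ (fun x => G (Phi (f x))) (fun=> w)).
    apply: (@continuous_comp _ _ _ (Phi \o f) G).
      by apply: (@continuous_comp _ _ _ f Phi); [exact: f_cont|exact: Phi_cont].
    exact: lipschitz_continuous GL _.
  exact: cst_continuous.
(* Since x = G (f x) and [Phi] moves points by at most [e], the deviation from the identity is at
   most c * e + |w| <= r. *)
- move=> x xr; rewrite -[X in _ - _ - X](GK x xr) addrAC.
  rewrite (le_trans (ler_normB _ _)) // -[leRHS](subrK (c * e) r) [leRHS]addrC.
  rewrite lerD //; last first.
    by rewrite (le_trans w_le) // /eta ge_min lexx orbT.
  rewrite (le_trans (GL _ _)) // ler_pM2l //.
  have tf := ftau x xr; have [ef|fe] := leP e `|f x - y|.
    by rewrite /Phi k_far // scale1r [y + _]addrC subrK subrr normr0 ltW.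
  rewrite /Phi [X in `|X|](_ : _ = (k (f x) - 1) *: (f x - y)); last first.
    by rewrite scalerBl scale1r opprB addrA [y + _]addrC.
  rewrite normrZ ger0_norm; last by rewrite subr_ge0 /k le_max lexx.
  by rewrite mulrBl mul1r k_near // gerBl.
move/eqP; rewrite subr_eq0; apply/negP.
(* If [Phi] fixes f x, then x = w, whose image lies inside the sphere; otherwise Phi (f x) is on the
   sphere, where [G] avoids [w]. *)
have tf := ftau x xr; have [ef|fe] := leP e `|f x - y|.
  rewrite /Phi k_far // scale1r [y + _]addrC subrK GK //; apply/eqP => xw.
  suff xmu : `|x| < mu by have := fmu x xmu; rewrite ltNge ef.
  rewrite xw (le_lt_trans w_le) // gt_min; apply/orP; left; lra.
apply: Gw; rewrite /Phi addrAC subrr add0r normrZ ger0_norm ?k_near //.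
by rewrite /k le_max ler01.
Qed.

(** On the ball of radius r/c the Lipschitz left inverse [G] of [f] is also a right inverse, so H (G
    y) differs from y = f (G y) by at most r/c and Brouwer's theorem applies. *)
Lemma perturbed_zero (R : realType) (n : nat) (f H : 'rV[R]_n -> 'rV[R]_n) (c r Rb : R) :
  0 < c -> 0 <= r < Rb -> continuous f -> continuous H -> f 0 = 0 ->
  (forall x y, `|x| < Rb -> `|y| < Rb -> `|x - y| <= c * `|f x - f y|) ->
  (forall x, `|x| <= r -> c * `|H x - f x| <= r) ->
  exists2 x, `|x| <= r & H x = 0.
Proof.
move=> c0 /andP[r0 rRb] f_cont H_cont f0 fc Hf.
move: r0; rewrite le_eqVlt => /predU1P[r0|r0].
  subst r; exists 0; rewrite ?normr0 //; apply/eqP; rewrite -normr_le0.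
  by have := Hf 0; rewrite normr0 f0 subr0 pmulr_rle0 // => /(_ (lexx _)).
(* A radius strictly between: [f] is expansive on the closed ball, and c * |y| <= r < r' gives
   preimages. *)
pose r' := (r + Rb) / 2.
have [rr' r'Rb] : r < r' /\ r' < Rb by rewrite /r'; split; lra.
have r'0 : 0 < r' by exact: lt_trans rr'.
have fc' x y : `|x| <= r' -> `|y| <= r' -> `|x - y| <= c * `|f x - f y|.
  by move=> xr yr; apply: fc; exact: le_lt_trans r'Rb.
have [G GL GK] := lipschitz_left_inverse (ltW c0) (ltW r'0) fc'.
have GP y : `|y| <= r / c -> `|G y| <= r /\ f (G y) = y.
  rewrite ler_pdivlMr // mulrC => yr.
  have [x xr' fx] := ball_sub_image c0 r'0 f_cont f0 fc' (le_lt_trans yr rr').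
  rewrite -fx GK //; split=> //.
  have := fc' x 0 xr'; rewrite normr0 f0 !subr0 fx => /(_ (ltW r'0)).
  by move=> /le_trans; apply.
have rc0 : 0 < r / c by rewrite divr_gt0.
have [||y yr Hy] := @continuous_zero_in_ball R n (H \o G) (r / c) rc0.
- move=> y; apply: continuous_comp; last exact: H_cont.
  exact: lipschitz_continuous GL _.
- move=> y yr /=; have [Gr fG] := GP y yr.
  by rewrite -[X in _ - X]fG ler_pdivlMr // mulrC Hf.
by exists (G y) => //; case: (GP y yr).
Qed.

(** * Secant lines *)

Definition slope {R : realType} (phi : R -> R) (a b : R) : R :=
  if a == b then derive1 phi ((a + b) / 2) else (phi a - phi b) / (a - b).

Definition secant_line {R : realType} (phi : R -> R) (a b t : R) : R :=
  (phi a + phi b) / 2 + slope phi a b * (t - (a + b) / 2).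

Section SecantLine.
Context {R : realType} (phi : R -> R) (J : set R).
Implicit Types (a b p q s t u L : R).

Lemma half_sum a : (a + a) / 2 = a.
Proof. by field. Qed.

Lemma secant_lineE a b t : secant_line phi a b t = phi a + slope phi a b * (t - a).
Proof.
rewrite /secant_line /slope; case: eqVneq => [->|ab]; first by rewrite !half_sum.
by field; rewrite subr_eq0.
Qed.

Lemma slopeC a b : slope phi a b = slope phi b a.
Proof.
rewrite /slope eq_sym; case: eqVneq => [->//|ab].
by rewrite -(opprB (phi b)) -(opprB b) invrN mulrNN.
Qed.

Lemma secant_lineC a b t : secant_line phi a b t = secant_line phi b a t.
Proof. by rewrite /secant_line slopeC [phi a + _]addrC [a + _]addrC. Qed.

Lemma dist_between a b s t : Num.min a b <= s <= Num.max a b ->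
  Num.min a b <= t <= Num.max a b -> `|s - t| <= `|a - b|.
Proof.
case: (leP a b) => ab /andP[s1 s2] /andP[t1 t2].
  by rewrite [leRHS]ler0_norm ?subr_le0 // ler_norml; apply/andP; split; lra.
by rewrite [leRHS]gtr0_norm ?subr_gt0 // ler_norml; apply/andP; split; lra.
Qed.

Lemma between_trans a b s t : Num.min a b <= s <= Num.max a b ->
  Num.min a s <= t <= Num.max a s -> Num.min a b <= t <= Num.max a b.
Proof.
case: (leP a b) => ab /andP[s1 s2].
  by rewrite (min_idPl s1) (max_idPr s1) => /andP[-> ts]; exact: le_trans ts s2.
by rewrite (min_idPr s2) (max_idPl s2) => /andP[st ->]; rewrite (le_trans s1 st).
Qed.

Lemma between_three u p q : [|| Num.min u q <= p <= Num.max u q,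
  Num.min u p <= q <= Num.max u p | Num.min p q <= u <= Num.max p q].
Proof.
rewrite !ge_min !le_max.
case: (leP u p) => [_|/ltW ->]; case: (leP u q) => [_|/ltW ->];
  rewrite ?orbT ?andbT ?lexx //=; case: (leP p q) => [_|/ltW ->]; rewrite ?orbT //.
Qed.

Hypothesis J_itv : is_interval J.
Hypothesis J_derivable : forall t, J t -> derivable phi t 1.

Lemma between_in a b t : J a -> J b -> Num.min a b <= t <= Num.max a b -> J t.
Proof. by move=> Ja Jb; case: (leP a b) => ab; exact: J_itv. Qed.

Lemma mean_value a b : J a -> J b ->
  exists2 t, Num.min a b <= t <= Num.max a b &
    phi b - phi a = derive1 phi t * (b - a).
Proof.
have le_case : forall a b, a <= b -> J a -> J b ->
  exists2 t, a <= t <= b & phi b - phi a = derive1 phi t * (b - a).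
  move=> {}a {}b ab Ja Jb.
  have Jt t : t \in `[a, b]%R -> J t by rewrite in_itv; exact: J_itv.
  have [||t] := @MVT_segment R phi (derive1 phi) a b ab; last first.
  - by rewrite in_itv => t_itv E; exists t.
  - by apply: derivable_within_continuous => t /Jt; exact: J_derivable.
  - move=> t t_itv; rewrite derive1E; apply/derivableP/J_derivable/Jt.
    exact: subset_itv_oo_cc.
move=> Ja Jb; case: (leP a b) => ab; first exact: le_case.
have [t t_itv E] := le_case _ _ (ltW ab) Jb Ja; exists t => //.
by rewrite -opprB E -mulrN opprB.
Qed.

Lemma slope_mean_value a b : J a -> J b ->
  exists2 t, Num.min a b <= t <= Num.max a b & slope phi a b = derive1 phi t.
Proof.
move=> Ja Jb; rewrite /slope; case: eqVneq => [->|ab].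
  by exists b; rewrite ?half_sum ?minxx ?maxxx ?lexx.
have [t t_itv E] := mean_value Jb Ja.
by exists t; [rewrite minC maxC|rewrite E mulfK // subr_eq0].
Qed.

Lemma slope_le L a b : (forall t, J t -> `|derive1 phi t| <= L) -> J a -> J b ->
  `|slope phi a b| <= L.
Proof.
move=> phiL Ja Jb; have [t t_itv ->] := slope_mean_value Ja Jb.
exact/phiL/(between_in Ja Jb).
Qed.

Hypothesis (L' : R) (L'0 : 0 <= L').
Hypothesis dphi_lip : forall s t, J s -> J t ->
  `|derive1 phi s - derive1 phi t| <= L' * `|s - t|.

(** Mean values turn the error into a difference of two derivatives. The cases are which of the
    three points lies between the others: both derivatives are then taken between the outer two. *)
Lemma secant_line_interpolation p q u : J p -> J q -> J u ->
  `|secant_line phi p q u - phi u| <= L' * (`|p - u| * `|q - u|).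
Proof.
have inner : forall p q, J p -> J q -> J u -> Num.min u q <= p <= Num.max u q ->
    `|secant_line phi p q u - phi u| <= L' * (`|p - u| * `|q - u|).
  move=> {}p {}q Jp Jq Ju p_itv; rewrite secant_lineE.
  have [t t_itv tE] := mean_value Ju Jp; have [s s_itv sE] := slope_mean_value Jp Jq.
  have Jt := between_in Ju Jp t_itv; have Js := between_in Jp Jq s_itv.
  have -> : phi p + slope phi p q * (u - p) - phi u =
      (p - u) * (derive1 phi t - derive1 phi s).
    by rewrite addrAC tE sE; ring.
  rewrite normrM mulrCA ler_wpM2l // (le_trans (dphi_lip Jt Js)) // ler_wpM2l //.
  rewrite [leRHS]distrC dist_between //; first exact: between_trans t_itv.
  by move: p_itv s_itv; rewrite ![_ u q]minC ![_ u q]maxC ![_ p q]minC ![_ p q]maxC;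
    exact: between_trans.
move=> Jp Jq Ju; have [p_itv|] := boolP (Num.min u q <= p <= Num.max u q).
  exact: inner.
have [q_itv _|q_out p_out] := boolP (Num.min u p <= q <= Num.max u p).
  by rewrite secant_lineC [`|p - u| * _]mulrC inner.
have pq : p != q.
  by apply: contraNneq p_out => ->; rewrite ge_min lexx le_max lexx !orbT.
have u_itv : Num.min p q <= u <= Num.max p q.
  by have := between_three u p q; rewrite (negbTE p_out) (negbTE q_out).
have [t t_itv tE] := mean_value Ju Jp; have [s s_itv sE] := mean_value Ju Jq.
have Jt := between_in Ju Jp t_itv; have Js := between_in Ju Jq s_itv.
have pq0 : 0 < `|p - q| by rewrite normr_gt0 subr_eq0.
rewrite -(ler_pM2r pq0) -[leLHS]normrM.
(* With [u] in the middle the factor p - q clears the denominator and is recovered from the distance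
   of [s] and [t]. *)
have -> : (secant_line phi p q u - phi u) * (p - q) =
    (p - u) * (q - u) * (derive1 phi s - derive1 phi t).
  transitivity ((phi q - phi u) * (p - u) - (phi p - phi u) * (q - u)); last first.
    by rewrite tE sE; ring.
  by rewrite secant_lineE /slope (negbTE pq); field; rewrite subr_eq0.
rewrite !normrM [L' * _]mulrC -[leRHS]mulrA ler_wpM2l ?mulr_ge0 //.
rewrite (le_trans (dphi_lip Js Jt)) // ler_wpM2l // dist_between //.
  rewrite minC maxC in u_itv; rewrite minC maxC in s_itv; rewrite minC maxC.
  exact: between_trans s_itv.
rewrite minC maxC in t_itv; exact: between_trans t_itv.
Qed.

(** The difference is the interpolation error at [u] plus a difference of slopes times t - u; the
    secant slope is a derivative between [p] and [q]. *)
Lemma secant_tangent_line p q u t : J p -> J q -> J u ->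
  `|secant_line phi p q t - secant_line phi u u t| <=
    L' * (`|p - u| * `|q - u| + Num.max `|p - u| `|q - u| * `|t - u|).
Proof.
move=> Jp Jq Ju; have [s s_itv sE] := slope_mean_value Jp Jq.
have Js := between_in Jp Jq s_itv.
have -> : secant_line phi p q t - secant_line phi u u t =
    (secant_line phi p q u - phi u) + (derive1 phi s - derive1 phi u) * (t - u).
  by rewrite !secant_lineE -sE [slope phi u u]/slope eqxx half_sum; ring.
rewrite [leRHS]mulrDr (le_trans (ler_normD _ _)) // lerD ?secant_line_interpolation //.
rewrite normrM mulrA ler_wpM2r // (le_trans (dphi_lip Js Ju)) // ler_wpM2l //.
have bound a b : a <= s <= b -> `|s - u| <= Num.max `|a - u| `|b - u|.
  move=> /andP[as_ sb]; rewrite le_max; have [su|us] := leP s u; apply/orP.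
    left; rewrite ler0_norm ?subr_le0 // opprB distrC.
    by rewrite (le_trans _ (ler_norm _)) // lerD2l lerN2.
  by right; rewrite gtr0_norm ?subr_gt0 // (le_trans _ (ler_norm _)) // lerD2r.
by move: s_itv; case: (leP p q) => pq /bound //; rewrite maxC.
Qed.

End SecantLine.

(** * Evaluation traces *)

Section Trace.
Context {R : realType} {n : nat} (p : program R n) {T : Type} (x0 : T).
Variables (init : seq T) (step : 'I_(len p) -> seq T -> T).
Hypothesis size_init : size init = n.
Let run vs (s : seq 'I_(len p)) := foldl (fun vs i => rcons vs (step i vs)) vs s.

Lemma nth_run vs s j : (j < size vs)%N -> nth x0 (run vs s) j = nth x0 vs j.
Proof.
elim: s vs => //= i s IHs vs jvs.
by rewrite IHs ?size_rcons ?leqW // nth_rcons jvs.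
Qed.

Lemma size_run vs s : size (run vs s) = (size vs + size s)%N.
Proof.
by elim: s vs => [|i s IHs] vs /=; rewrite ?addn0 // IHs size_rcons addSnnS.
Qed.

Lemma nth_trace_init j : (j < n)%N -> nth x0 (trace init step) j = nth x0 init j.
Proof. by move=> jn; apply: nth_run; rewrite size_init. Qed.

(** Instructions only append, so the list seen by instruction [i] agrees with the final trace on the
    earlier slots. This turns the fold into recurrences. *)
Lemma nth_trace_step (i : 'I_(len p)) : exists2 vs,
  forall j, (j < n + i)%N -> nth x0 vs j = nth x0 (trace init step) j &
  nth x0 (trace init step) (n + i) = step i vs.
Proof.
pose vs := run init (take i (enum 'I_(len p))).
have size_vs : size vs = (n + i)%N.
  by rewrite size_run size_init size_takel // size_enum_ord ltnW.
have E : trace init step = run (rcons vs (step i vs)) (drop i.+1 (enum 'I_(len p))).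
  rewrite /trace -[X in foldl _ _ X](cat_take_drop i) foldl_cat.
  by rewrite (drop_nth i) ?size_enum_ord // nth_ord_enum.
exists vs => [j jvs|]; rewrite E nth_run ?size_rcons ?size_vs ?leqnn ?leqW //.
  by rewrite nth_rcons size_vs jvs.
by rewrite nth_rcons size_vs ltnn eqxx.
Qed.

End Trace.

(** * Slotwise recurrences for values, models and constants *)

Section Slots.
Context {R : realType} {n : nat} (p : program R n).
Implicit Types (x xc xh : 'rV[R]_n) (i : 'I_(len p)) (K : set 'rV[R]_n).

Lemma slot_ind (P : nat -> Prop) : (forall j : 'I_n, P j) ->
  (forall i, (forall j, (j < n + i)%N -> P j) -> P (n + i)%N) ->
  forall m, (m < n + len p)%N -> P m.
Proof.
move=> Pin Pstep; elim/ltn_ind => m IHm lem.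
have [lemn|lenm] := ltnP m n; first exact: (Pin (Ordinal lemn)).
have lt : (m - n < len p)%N by lia.
have -> : m = (n + Ordinal lt)%N by rewrite /= subnKC.
by apply: Pstep => j /=; rewrite subnKC // => jm; apply: IHm => //; exact: ltn_trans lem.
Qed.

Lemma size_inputs x : size (inputs x) = n.
Proof. by rewrite size_map size_enum_ord. Qed.

Lemma nth_inputs x (j : 'I_n) : (inputs x)`_j = x 0 j.
Proof. by rewrite (nth_map j) ?size_enum_ord // nth_ord_enum. Qed.

Lemma val_at_input x (j : 'I_n) : val_at p j x = x 0 j.
Proof. by rewrite /val_at nth_trace_init ?size_inputs // nth_inputs. Qed.

Lemma val_at_step x i : val_at p (n + i) x =
  match ins i with
  | Sum j k => val_at p j x + val_at p k x
  | Abs j => `|val_at p j x|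
  | Elem phi j => phi (val_at p j x)
  end.
Proof.
rewrite /val_at; have [vs vsE ->] := nth_trace_step 0
  (fun i vs => match ins i with
    | Sum j k => vs`_j + vs`_k
    | Abs j => `|vs`_j|
    | Elem phi j => phi vs`_j
    end) (size_inputs x) i.
by case: (ins i) => [j k|j|phi j]; rewrite !vsE.
Qed.

(** The model of a single slot. With mean value and increment added up, [Abs] acts as a plain
    absolute value and [Elem] as a secant line. *)
Definition model_at xc xh m x : R :=
  (val_at p m xc + val_at p m xh) / 2 + (increments p xc xh (x - midpoint xc xh))`_m.

Lemma model_at_input xc xh (j : 'I_n) x : model_at xc xh j x = x 0 j.
Proof.
rewrite /model_at !val_at_input nth_trace_init ?size_inputs // nth_inputs !mxE.
by field.
Qed.

Lemma model_at_step xc xh i x : model_at xc xh (n + i) x =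
  match ins i with
  | Sum j k => model_at xc xh j x + model_at xc xh k x
  | Abs j => `|model_at xc xh j x|
  | Elem phi j =>
      secant_line phi (val_at p j xc) (val_at p j xh) (model_at xc xh j x)
  end.
Proof.
rewrite /model_at; set dx := x - _; rewrite /increments.
set step := (X in trace _ X); have [dv dvE ->] := nth_trace_step 0 step (size_inputs dx) i.
rewrite /step !val_at_step; case: (ins i) => [j k|j|phi j]; rewrite !dvE //.
- by field.
- by rewrite addrC subrK.
- by rewrite /secant_line /slope [_ + _ - _]addrAC subrr add0r.
Qed.

Lemma secant_modelE xc xh x :
  secant_model p xc xh x = \row_(i < n) model_at xc xh (len p + i) x.
Proof. by apply/rowP => i; rewrite !mxE /model_at mulrC. Qed.

Definition beta_at K m : R := (nth (0, 0) (bounds p K) m).1.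
Definition gamma_at K m : R := (nth (0, 0) (bounds p K) m).2.

Lemma bounds_input K (j : 'I_n) : beta_at K j = 1 /\ gamma_at K j = 0.
Proof. by rewrite /beta_at /gamma_at nth_trace_init ?size_nseq // nth_nseq ltn_ord. Qed.

Lemma bounds_step K i : (beta_at K (n + i), gamma_at K (n + i)) =
  match ins i with
  | Sum j k => (beta_at K j + beta_at K k, gamma_at K j + gamma_at K k)
  | Abs j => (beta_at K j, gamma_at K j)
  | Elem phi j =>
      let L := fine (sup_derive K phi (val_at p j)) in
      let L' := fine (lip_derive K phi (val_at p j)) in
      (beta_at K j * L, L * gamma_at K j + L' * beta_at K j ^+ 2)
  end.
Proof.
rewrite /beta_at /gamma_at -surjective_pairing /bounds.
set step := (X in trace _ X).
have [bs bsE ->] := nth_trace_step (0, 0) step (size_nseq n (1, 0)) i.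
by rewrite /step; case: (ins i) => [j k|j|phi j]; rewrite !bsE.
Qed.

Lemma secant_model_lipschitz xc xh : exists2 C, 0 <= C &
  forall x y, `|secant_model p xc xh x - secant_model p xc xh y| <= C * `|x - y|.
Proof.
have lip m : (m < n + len p)%N -> exists2 C, 0 <= C & forall x y,
    `|model_at xc xh m x - model_at xc xh m y| <= C * `|x - y|.
  move: m; apply: slot_ind => [j|i IH].
    exists 1 => // x y; rewrite !model_at_input mul1r.
    by have := norm_coord_le (x - y) j; rewrite !mxE.
  case Ei : (ins i) => [j k|j|phi j].
  - have [C C0 CP] := IH j (ltn_ord j); have [B B0 BP] := IH k (ltn_ord k).
    exists (C + B) => [|x y]; rewrite ?addr_ge0 // !model_at_step Ei.
    by rewrite opprD addrACA mulrDl (le_trans (ler_normD _ _)) // lerD.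
  - have [C C0 CP] := IH j (ltn_ord j); exists C => // x y.
    by rewrite !model_at_step Ei (le_trans (ler_dist_dist _ _)).
  - have [C C0 CP] := IH j (ltn_ord j).
    pose s := slope phi (val_at p j xc) (val_at p j xh).
    exists (`|s| * C) => [|x y]; first by rewrite mulr_ge0.
    rewrite !model_at_step Ei /secant_line -/s opprD addrACA subrr add0r -mulrBr.
    by rewrite opprD addrACA subrr addr0 normrM -mulrA ler_wpM2l.
have /choice[C CP] : forall i : 'I_n, exists C, 0 <= C /\ forall x y,
    `|model_at xc xh (len p + i) x - model_at xc xh (len p + i) y| <= C * `|x - y|.
  by move=> i; have [|C C0 CP] := lip (len p + i)%N; [rewrite addnC ltn_add2r|exists C].
have C0 (i : 'I_n) : 0 <= C i by case: (CP i).
exists (\sum_i C i) => [|x y]; first by apply: sumr_ge0.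
apply: rV_norm_le => [|j]; first by rewrite mulr_ge0 ?sumr_ge0.
rewrite !secant_modelE !mxE; have [_ /(_ x y) /le_trans] := CP j; apply.
by rewrite ler_wpM2r // (bigD1 j) //= lerDl sumr_ge0.
Qed.

End Slots.

Section SupLip.
Context {R : realType} {n : nat} (K : set 'rV[R]_n) (phi : R -> R) (u : 'rV[R]_n -> R).

Lemma sup_derive_le x : sup_derive K phi u \is a fin_num -> K x ->
  `|derive1 phi (u x)| <= fine (sup_derive K phi u).
Proof.
by move=> fin Kx; rewrite -lee_fin fineK //; apply: ereal_sup_ubound; exists x.
Qed.

Lemma lip_derive_ge0 : lip_derive K phi u \is a fin_num -> 0 <= fine (lip_derive K phi u).
Proof.
move=> fin; rewrite -lee_fin fineK //; apply: le_ereal_inf_tmp => _ [k [k0 _] <-].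
by rewrite lee_fin.
Qed.

(** The infimum is itself a Lipschitz constant: every admissible k is at least the difference
    quotient of each fixed pair. *)
Lemma lip_derive_le s t : lip_derive K phi u \is a fin_num ->
  (u @` K) s -> (u @` K) t ->
  `|derive1 phi s - derive1 phi t| <= fine (lip_derive K phi u) * `|s - t|.
Proof.
move=> fin Ks Kt; have [->|st] := eqVneq s t; first by rewrite !subrr normr0 mulr0.
have st0 : 0 < `|s - t| by rewrite normr_gt0 subr_eq0.
rewrite -ler_pdivrMr // -lee_fin fineK //; apply: le_ereal_inf_tmp => _ [k [k0 klip] <-].
by rewrite lee_fin ler_pdivrMr //; exact: (klip (s, t)).
Qed.

End SupLip.

(** * Comparison of the secant and tangent models *)

(** Intermediate values along a segment. It allows mean values between points of u(K), where alone
    the derivative is controlled. *)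
Lemma lipschitz_convex_image (R : realType) (n : nat) (K : set 'rV[R]_n)
    (u : 'rV[R]_n -> R) (B : R) :
  0 <= B -> convex_set K ->
  (forall x y, K x -> K y -> `|u x - u y| <= B * `|x - y|) ->
  is_interval (u @` K).
Proof.
move=> B0 convK uB _ _ [x Kx <-] [y Ky <-] z /andP[xz zy].
(* Clamping the parameter to [0, 1] keeps the path in [K], and Lipschitz, on the whole line. *)
pose cl (t : R) : R := Num.max 0 (Num.min 1 t).
pose w t := cl t *: y + (1 - cl t) *: x.
have cl01 t : 0 <= cl t <= 1.
  by rewrite /cl le_max lexx ge_max ler01 ge_min lexx.
have Kw t : K (w t).
  have /andP[t0 t1] := cl01 t.
  by have := convK y x (Itv01 t0 t1); rewrite !inE; exact.
have cl_lip s t : `|cl s - cl t| <= `|s - t|.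
  have clE r : [\/ r <= 0 /\ cl r = 0, 0 <= r <= 1 /\ cl r = r | 1 <= r /\ cl r = 1].
    rewrite /cl; case: (leP 1 r) => r1; first by rewrite (max_idPr ler01); apply: Or33.
    by case: (leP 0 r) => r0; [apply: Or32; rewrite (ltW r1)|apply: Or31; rewrite (ltW r0)].
  have := ler_norm (s - t); have := ler_norm (t - s); rewrite distrC ler_norml.
  by case: (clE s) => -[? ->]; case: (clE t) => -[? ->] ? ?; apply/andP; split; lra.
have h_cont : continuous (u \o w).
  apply: (@lipschitz_continuous _ R^o R^o _ (B * `|y - x|)) => s t.
  rewrite (le_trans (uB _ _ (Kw s) (Kw t))) // -mulrA ler_wpM2l // mulrC.
  have -> : w s - w t = (cl s - cl t) *: (y - x).
    by apply/rowP => j; rewrite !mxE; ring.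
  by rewrite normrZ ler_wpM2r.
have w0 : w 0 = x by rewrite /w /cl min_r ?ler01 // maxxx scale0r subr0 scale1r add0r.
have w1 : w 1 = y by rewrite /w /cl minxx (max_idPr ler01) scale1r subrr scale0r addr0.
have [||t _ ht] := @IVT R (u \o w) 0 1 z ler01.
- exact: continuous_subspaceT.
- by rewrite /= w0 w1 ge_min xz le_max zy orbT.
by exists (w t).
Qed.

Section ModelBounds.
Context {R : realType} {n : nat} {Omega : set 'rV[R]_n}.
Variables (F : evaluation_procedure Omega) (K : set 'rV[R]_n) (x0 : 'rV[R]_n).
Hypotheses (convK : convex_set K) (subK : K `<=` Omega) (Kx0 : K x0).
Hypothesis finK : finite_constants F K.
Local Notation v := (val_at F).
Local Notation mdl := (model_at F).
Local Notation beta := (beta_at F K).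
Local Notation gamma := (gamma_at F K).

Definition model_gap (xs xc xh x : 'rV[R]_n) : R :=
  `|xc - xs| * `|xh - xs| + Num.max `|xc - xs| `|xh - xs| * `|x - xs|.

(** The bounds are proved together because the last one, at an elemental, uses the others for its
    argument; beta^2 arises from products of two value or model differences. *)
Lemma model_bounds m : (m < n + len F)%N ->
  [/\ 0 <= beta m,
      forall x y, K x -> K y -> `|v m x - v m y| <= beta m * `|x - y|,
      forall xs x, K xs -> `|mdl xs xs m x - v m xs| <= beta m * `|x - xs| &
      forall xs xc xh x, K xs -> K xc -> K xh ->
        `|mdl xc xh m x - mdl xs xs m x| <= gamma m * model_gap xs xc xh x].
Proof.
move: m; apply: slot_ind => [j|i IH].
  have [-> ->] := bounds_input F K j; split=> // [x y _ _|xs x _|xs xc xh x _ _ _].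
  - by have := norm_coord_le (x - y) j; rewrite !val_at_input mul1r !mxE.
  - by have := norm_coord_le (x - xs) j; rewrite model_at_input val_at_input mul1r !mxE.
  - by rewrite !model_at_input subrr normr0 mul0r.
have := bounds_step K i; case Ei : (ins i) => [j k|j|phi j] [-> ->].
- have [bj0 lipj tanj secj] := IH j (ltn_ord j).
  have [bk0 lipk tank seck] := IH k (ltn_ord k).
  split=> [|x y Kx Ky|xs x Ks|xs xc xh x Ks Kc Kh].
  + exact: addr_ge0.
  + rewrite !val_at_step Ei opprD addrACA mulrDl (le_trans (ler_normD _ _)) //.
    by rewrite lerD ?lipj ?lipk.
  + rewrite model_at_step val_at_step Ei opprD addrACA mulrDl.
    by rewrite (le_trans (ler_normD _ _)) // lerD ?tanj ?tank.
  + rewrite !model_at_step Ei opprD addrACA mulrDl.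
    by rewrite (le_trans (ler_normD _ _)) // lerD ?secj ?seck.
- have [bj0 lipj tanj secj] := IH j (ltn_ord j).
  split=> [//|x y Kx Ky|xs x Ks|xs xc xh x Ks Kc Kh].
  + by rewrite !val_at_step Ei (le_trans (ler_dist_dist _ _)) // lipj.
  + by rewrite model_at_step val_at_step Ei (le_trans (ler_dist_dist _ _)) // tanj.
  + by rewrite !model_at_step Ei (le_trans (ler_dist_dist _ _)) // secj.
have [b0 lipj tanj secj] := IH j (ltn_ord j).
have [finL finL'] := finK Ei.
set L := fine (sup_derive _ _ _); set L' := fine (lip_derive _ _ _).
pose J := v j @` K.
have J_itv : is_interval J by exact: lipschitz_convex_image lipj.
have J_der t : J t -> derivable phi t 1.
  by move=> [x Kx <-]; apply/efun_derivable/(code_defined Ei)/subK.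
have J_L t : J t -> `|derive1 phi t| <= L.
  by move=> [x Kx <-]; exact: sup_derive_le.
have L0 : 0 <= L by apply: le_trans (J_L (v j x0) _) => //; exists x0.
have L'0 : 0 <= L' by exact: lip_derive_ge0.
have J_L' s t : J s -> J t -> `|derive1 phi s - derive1 phi t| <= L' * `|s - t|.
  exact: lip_derive_le.
have Jv x : K x -> J (v j x) by exists x.
split=> [|x y Kx Ky|xs x Ks|xs xc xh x Ks Kc Kh].
- exact: mulr_ge0.
- rewrite !val_at_step Ei.
  have [t t_itv ->] := mean_value J_itv J_der (Jv _ Ky) (Jv _ Kx).
  have Jt := between_in J_itv (Jv _ Ky) (Jv _ Kx) t_itv.
  by rewrite normrM mulrAC mulrC ler_pM ?J_L ?lipj.
- rewrite model_at_step val_at_step Ei secant_lineE addrAC subrr add0r normrM.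
  by rewrite mulrAC mulrC ler_pM ?tanj // (slope_le J_itv J_der J_L) //; exact: Jv.
rewrite !model_at_step Ei; set t1 := mdl xc xh j x; set t2 := mdl xs xs j x.
set p := v j xc; set q := v j xh; set u := v j xs.
(* Inserting the secant line at [t2]: moving [t1] to [t2] costs a slope, at most L, and exchanging
   the lines at [t2] costs the L' term. *)
rewrite -[X in `|X - _|](subrK (secant_line phi p q t2)) -addrA.
rewrite [leRHS]mulrDl (le_trans (ler_normD _ _)) // lerD //.
  rewrite !secant_lineE opprD addrACA subrr add0r -mulrBr opprD addrACA subrr addr0.
  rewrite normrM -mulrA ler_pM ?secj // (slope_le J_itv J_der J_L) //; exact: Jv.
have := secant_tangent_line J_itv J_der L'0 J_L' t2 (Jv _ Kc) (Jv _ Kh) (Jv _ Ks).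
move=> /le_trans; apply; rewrite -mulrA ler_wpM2l // mulrDr.
rewrite expr2; apply: lerD.
  by rewrite mulrACA ler_pM ?lipj.
rewrite [leRHS]mulrACA ler_pM ?tanj // ?le_max ?normr_ge0 //.
rewrite ge_max; apply/andP; split.
  by rewrite (le_trans (lipj _ _ Kc Ks)) // ler_wpM2l // le_max lexx.
by rewrite (le_trans (lipj _ _ Kh Ks)) // ler_wpM2l // le_max lexx orbT.
Qed.

Lemma tangent_model_base xs : K xs -> tangent_model F xs xs = evaluate F xs.
Proof.
move=> Ks; apply/rowP => i; rewrite /tangent_model secant_modelE !mxE.
have [|_ _ /(_ xs xs Ks) + _] := @model_bounds (len F + i)%N.
  by rewrite addnC ltn_add2r.
by rewrite subrr normr0 mulr0 normr_le0 subr_eq0 => /eqP.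
Qed.

Lemma secant_tangent_model xs xc xh x : K xs -> K xc -> K xh ->
  `|secant_model F xc xh x - tangent_model F xs x| <=
    (\big[Num.max/0]_(i < n) gamma (len F + i)%N) * model_gap xs xc xh x.
Proof.
move=> Ks Kc Kh; set g := \big[_/_]_(_ < _) _.
have gap0 : 0 <= model_gap xs xc xh x.
  by rewrite /model_gap addr_ge0 ?mulr_ge0 // le_max normr_ge0.
have g0 : 0 <= g by apply/bigmax_geP; left.
apply: rV_norm_le => [|i]; first exact: mulr_ge0.
rewrite /tangent_model !secant_modelE !mxE.
have [|_ _ _ /(_ xs xc xh x Ks Kc Kh) /le_trans] := @model_bounds (len F + i)%N.
  by rewrite addnC ltn_add2r.
apply; rewrite ler_wpM2r //; apply/bigmax_geP; right; exists i => //.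
Qed.

End ModelBounds.

(** * The Newton step *)

(** The roots not farther from [a] than [z] form a compact set. *)
Lemma nearest_roots_nonempty (R : realType) (n : nat) (G : 'rV[R]_n -> 'rV[R]_n)
    (a z : 'rV[R]_n) :
  continuous G -> G z = 0 -> nearest_roots G a !=set0.
Proof.
move=> G_cont Gz.
have normB_cont : continuous (fun x : 'rV[R]_n => `|x - a|).
  apply: (@lipschitz_continuous R _ R^o _ 1) => x y.
  by rewrite mul1r (le_trans (ler_dist_dist _ _)) // opprB addrA subrK.
have normG_cont : continuous (fun x => `|G x|).
  move=> x; apply: (@continuous_comp _ _ _ G Num.norm); first exact: G_cont.
  exact: norm_continuous.
pose A := [set x | `|G x| <= 0] `&` [set x : 'rV[R]_n | `|x - a| <= `|z - a|].
have [||| x] := @EVT_min_rV R n (fun x : 'rV[R]_n => `|x - a|) A.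
- by exists z; rewrite /A /= Gz normr0.
- apply: subclosed_compact (@compact_norm_le R n (`|z - a| + `|a|)) _.
    have sublevel (f : 'rV[R]_n -> R) t : continuous f -> closed [set x | f x <= t].
      by move=> /continuous_closedP/(_ [set s | s <= t] (@closed_le R t)).
    by apply: closedI; exact: sublevel.
  move=> x [_ /= xa]; rewrite -[x](subrK a) (le_trans (ler_normD _ _)) //.
  by rewrite lerD2r.
- exact: continuous_subspaceT.
rewrite inE => -[/=]; rewrite normr_le0 => /eqP Gx xz xmin; exists x; split=> // y Gy.
have [yz|/ltW zy] := leP `|y - a| `|z - a|; last exact: le_trans zy.
by apply: xmin; rewrite inE /A /= Gy normr0.
Qed.

(** Reduces the tangent mode to secant steps with coinciding base points. *)
Lemma newton_tangentE (R : realType) (n : nat) (Omega : set 'rV[R]_n)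
    (F : evaluation_procedure Omega) (x : 'rV[R]_n) :
  newton_tangent F x = newton_secant F x x.
Proof.
have mid : midpoint x x = x by apply/rowP => j; rewrite !mxE; field.
apply/seteqP; split=> y; rewrite /newton_tangent /newton_secant /= mid.
  by move=> [].
by move=> [].
Qed.

Section NewtonStep.
Context {R : realType} {n : nat} {Omega : set 'rV[R]_n}.
Variables (F : evaluation_procedure Omega) (xs : 'rV[R]_n) (Rb c gamma : R).
Local Notation D := (ball xs Rb).
Local Notation rho := (newton_radius Rb c gamma / 3).
Hypotheses (Rb0 : 0 < Rb) (c0 : 0 < c) (subD : D `<=` Omega).
Hypothesis root : evaluate F xs = 0.
Hypothesis bij : set_bij D (tangent_model F xs @` D) (tangent_model F xs).
Hypothesis reg : metric_regularity F xs D c.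
Hypothesis soc : second_order_constant F D gamma.

Lemma second_order_estimate : [/\ 0 <= gamma, tangent_model F xs xs = 0 &
  forall xc xh x, D xc -> D xh ->
    `|secant_model F xc xh x - tangent_model F xs x| <= gamma * model_gap xs xc xh x].
Proof.
have [K [convK DK KO finK ->]] := soc.
have Kxs : K xs by apply/DK/ballxx.
split=> [||xc xh x Dc Dh]; first by apply/bigmax_geP; left.
  by rewrite (tangent_model_base convK KO Kxs finK).
by apply: (secant_tangent_model convK KO Kxs finK) => //; exact: DK.
Qed.

(** Metric regularity at the value of the model in [y], whose preimage in [D] is [y]. *)
Lemma tangent_expansive x y : D x -> D y ->
  `|x - y| <= c * `|tangent_model F xs x - tangent_model F xs y|.
Proof.
move=> Dx Dy; case: bij => _ inj _.
have := reg Dx (imageP (tangent_model F xs) Dy).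
by rewrite /= (pinvKV _ inj) ?inE.
Qed.

Lemma newton_radiusP : [/\ 0 < rho, 3 * rho <= Rb & c * gamma * rho <= 3^-1].
Proof.
have [g0 _ _] := second_order_estimate; rewrite /newton_radius.
have [->|gn0] /= := eqVneq gamma 0.
  by have := Rb0; split; rewrite ?mulr0 ?mul0r ?invr_ge0 //; lra.
have cg0 : 0 < c * gamma by rewrite mulr_gt0 // lt_def gn0.
set r := Num.min _ _.
have r0 : 0 < r by rewrite lt_min Rb0 invr_gt0.
have rRb : r <= Rb by rewrite ge_min lexx.
have cgr : c * gamma * r <= 1.
  by rewrite mulrC -ler_pdivlMr // mul1r ge_min lexx orbT.
by split; lra.
Qed.

Lemma newton_step xh xc : ball xs rho xh -> ball xs rho xc ->
  newton_secant F xh xc !=set0 /\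
  forall x, newton_secant F xh xc x ->
    2 * rho * `|x - xs| <= `|xh - xs| * `|xc - xs|.
Proof.
have [rho0 rhoRb cgrho] := newton_radiusP.
have [g0 Gxs est] := second_order_estimate.
rewrite -!ball_normE /= ![`|xs - _|]distrC => eh_lt ec_lt.
set eh := `|xh - xs| in eh_lt *; set ec := `|xc - xs| in ec_lt *.
have Dball x : `|x - xs| < Rb -> D x by rewrite -ball_normE /= distrC.
have Dh : D xh by apply: Dball; rewrite -/eh; lra.
have Dc : D xc by apply: Dball; rewrite -/ec; lra.
pose e := Num.max ec eh.
have e0 : 0 <= e by rewrite le_max normr_ge0.
have e_lt : e < rho by rewrite gt_max ec_lt.
have [ec0 eh0] : 0 <= ec /\ 0 <= eh by split; exact: normr_ge0.
have [ece ehe] : ec <= e /\ eh <= e by rewrite !le_max !lexx orbT.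
have cg0 : 0 <= c * gamma by rewrite mulr_ge0 // ltW.
have S_cont xc' xh' : continuous (secant_model F xc' xh').
  by have [C _ /lipschitz_continuous] := secant_model_lipschitz F xc' xh'.
(* Within e/2 of the root the models differ by at most gamma * (3/2) e^2, and c * gamma * e <= 1/3
   turns this into the e/2 that [perturbed_zero] asks for. *)
have [z zr Sz] : exists2 z, `|z - xs| <= e / 2 & secant_model F xc xh z = 0.
  pose sh (x : 'rV[R]_n) := xs + x.
  have sh_cont : continuous sh.
    apply: (@lipschitz_continuous _ _ _ _ 1) => x y.
    by rewrite mul1r /sh opprD addrACA subrr add0r.
  have [||||x y xR yR|x xr|x xr Hx] := @perturbed_zero R n (tangent_model F xs \o sh)
      (secant_model F xc xh \o sh) c (e / 2) Rb c0.
  - by apply/andP; split; lra.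
  - by move=> x; apply: continuous_comp; [exact: sh_cont|exact: S_cont].
  - by move=> x; apply: continuous_comp; [exact: sh_cont|exact: S_cont].
  - by rewrite /= /sh addr0.
  - have := @tangent_expansive (sh x) (sh y).
    rewrite /= {1 2}/sh opprD addrACA subrr add0r; apply; apply: Dball.
      by rewrite addrC addKr.
    by rewrite addrC addKr.
  - rewrite (le_trans (ler_wpM2l (ltW c0) (est _ _ _ Dc Dh))) //.
    rewrite /model_gap -/e -/ec -/eh /sh [xs + x]addrC addrK mulrA.
    have gap_le : ec * eh + e * `|x| <= e * (3 / 2 * e).
      have : ec * eh <= e * e by rewrite ler_pM.
      have : e * `|x| <= e * (e / 2) by rewrite ler_wpM2l.
      lra.
    rewrite (le_trans (ler_wpM2l cg0 gap_le)) // mulrA.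
    have : c * gamma * e <= 3^-1.
      by rewrite (le_trans _ cgrho) // ler_wpM2l // ltW.
    move=> /(@ler_wpM2r _ (3 / 2 * e) (ltac:(lra))); lra.
  - by exists (sh x) => //; rewrite /sh addrC addKr.
have Oh := subD Dh; have Oc := subD Dc.
split=> [|x [_ _ [Sx xmin]]].
  have [y yP] := nearest_roots_nonempty (midpoint xh xc) (S_cont xc xh) Sz.
  by exists y.
have mid_le : `|midpoint xh xc - xs| <= e.
  have -> : midpoint xh xc - xs = 2^-1 *: ((xh - xs) + (xc - xs)).
    by apply/rowP => j; rewrite !mxE; field.
  rewrite normrZ gtr0_norm ?invr_gt0 // mulrC ler_pdivrMr //.
  by rewrite (le_trans (ler_normD _ _)) // -/eh -/ec; lra.
(* The minimizer is no farther from the midpoint than [z], so its distance to the root is at most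
   e/2 + e + e < 3 rho. *)
have Dx : D x.
  apply: Dball; set m := midpoint xh xc in xmin mid_le.
  have := xmin z Sz; have := ler_distD m x xs; have := ler_distD xs z m.
  rewrite [`|xs - m|]distrC; lra.
have d_le : `|x - xs| <= c * gamma * (ec * eh + e * `|x - xs|).
  have := tangent_expansive Dx (ballxx xs Rb0); rewrite Gxs => /le_trans; apply.
  have := est xc xh x Dc Dh; rewrite Sx sub0r normrN subr0 -mulrA => le.
  by rewrite ler_wpM2l // ltW.
set d := `|x - xs| in d_le *.
have d0 : 0 <= d by exact: normr_ge0.
(* Multiplied by rho, the estimate reads rho d <= (ec eh + rho d) / 3, and the term in d is absorbed
   on the left. *)
have := ler_wpM2r (ltW rho0) d_le.
have : e * d <= rho * d by rewrite ler_wpM2r // ltW.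
have : c * gamma * rho * (ec * eh + e * d) <= 3^-1 * (ec * eh + e * d).
  by rewrite ler_wpM2r // addr_ge0 ?mulr_ge0.
rewrite [eh * ec]mulrC [c * gamma * _ * rho]mulrAC [d * rho]mulrC -[2 * rho * d]mulrA.
lra.
Qed.

Lemma newton_step_contracts xh xc x : ball xs rho xh -> ball xs rho xc ->
  newton_secant F xh xc x -> `|x - xs| <= `|xh - xs| / 2.
Proof.
have [rho0 _ _] := newton_radiusP.
move=> xh_near xc_near Nx; have [_ /(_ x Nx)] := newton_step xh_near xc_near.
rewrite -mulrA => le; rewrite -(ler_pM2l rho0).
have : `|xh - xs| * `|xc - xs| <= `|xh - xs| * rho.
  by rewrite ler_wpM2l // ltW //; move: xc_near; rewrite -ball_normE /= distrC.
lra.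
Qed.

Lemma newton_step_ball xh xc x : ball xs rho xh -> ball xs rho xc ->
  newton_secant F xh xc x -> ball xs rho x.
Proof.
move=> xh_near xc_near /newton_step_contracts - /(_ xh_near xc_near) le.
move: xh_near; rewrite -!ball_normE /= ![`|xs - _|]distrC.
have := normr_ge0 (xh - xs); lra.
Qed.

(** * Convergence of the two iterations *)

Lemma tangent_newton_converges (x : nat -> 'rV[R]_n) :
  ball xs rho (x 0%N) -> tangent_run F x ->
  (forall k, newton_tangent F (x k) (x k.+1)) /\ converges_quadratically x xs.
Proof.
move=> x0 run; have [rho0 _ _] := newton_radiusP.
have x_run k : ball xs rho (x k) -> newton_secant F (x k) (x k) (x k.+1).
  move=> xk; rewrite -newton_tangentE; apply: run.
  by rewrite newton_tangentE; case: (newton_step xk xk).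
have x_near k : ball xs rho (x k).
  elim: k => // k k_near; exact: (newton_step_ball k_near k_near (x_run k k_near)).
split; first by move=> k; rewrite newton_tangentE; exact: x_run.
split; last first.
  have rho20 : 0 < 2 * rho by lra.
  exists (2 * rho)^-1 => k; rewrite (ler_pdivlMl _ _ rho20) expr2.
  by have [_] := newton_step (x_near k) (x_near k); apply; exact: x_run.
have x_geom k : `|x k - xs| <= rho * 2^-1 ^+ k.
  elim: k => [|k IHk].
    by rewrite expr0 mulr1 ltW //; move: x0; rewrite -ball_normE /= distrC.
  rewrite (le_trans (newton_step_contracts (x_near k) (x_near k) (x_run k _))) //.
  by rewrite exprSr mulrA ler_pM2r ?invr_gt0.
apply/(@cvgrPdist_lt _ _ _ (nbhs \oo)) => e e0.
have half_lt1 : `|2^-1 : R| < 1 by rewrite gtr0_norm; lra.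
have /cvgrPdist_lt/(_ (e / rho)) := cvg_expr half_lt1.
rewrite divr_gt0 // => /(_ isT); apply: filterS => k /=.
rewrite sub0r normrN normrX gtr0_norm ?invr_gt0 // ltr_pdivlMr // mulrC => ke.
by rewrite distrC (le_lt_trans (x_geom k)).
Qed.

(** Errors divided by 2 rho are bounded by the product of the two preceding ones. As p^2 = p + 1,
    the sequence q^(p^k) satisfies this recursion with equality, so it dominates once it does for k
    = 0 and 1. *)
Lemma secant_newton_converges (x : nat -> 'rV[R]_n) :
  ball xs rho (x 0%N) -> ball xs rho (x 1%N) -> secant_run F x ->
  (forall k, newton_secant F (x k.+1) (x k) (x k.+2)) /\
  converges_with_order ((1 + Num.sqrt 5) / 2) x xs.
Proof.
move=> x0 x1 run; have [rho0 _ _] := newton_radiusP.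
have x_run k : ball xs rho (x k) -> ball xs rho (x k.+1) ->
    newton_secant F (x k.+1) (x k) (x k.+2).
  by move=> k_near k1_near; apply: run; case: (newton_step k1_near k_near).
have x_near k : ball xs rho (x k) /\ ball xs rho (x k.+1).
  elim: k => // k [xk xk1]; split=> //.
  exact: newton_step_ball xk1 xk (x_run k xk xk1).
have {}x_run k : newton_secant F (x k.+1) (x k) (x k.+2).
  by have [] := x_near k; exact: x_run.
split=> //; set p := (1 + Num.sqrt 5) / 2.
have s5 : Num.sqrt 5 ^+ 2 = 5 :> R by rewrite sqr_sqrtr.
have s50 : 0 <= Num.sqrt 5 :> R by exact: sqrtr_ge0.
have p_sqr : p ^+ 2 = p + 1 by rewrite /p expr_div_n sqrrD s5; field.
have p1 : 1 <= p.
  have : 1 <= Num.sqrt 5 :> R by rewrite -(@ler_pXn2r _ 2) ?nnegrE // s5 expr1n; lra.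
  rewrite /p; lra.
have p0 : 0 < p by exact: lt_le_trans p1.
(* Chosen so that q^p = 1/2 and q >= 1/2: both scaled initial errors are at most 1/2. *)
pose q : R := 2^-1 `^ p^-1.
have h01 : 0 < (2^-1 : R) <= 1 by apply/andP; split; lra.
have q0 : 0 < q by apply: powR_gt0; lra.
have qp : q `^ p = 2^-1 by rewrite /q -powRrM mulVf ?powRr1 ?gt_eqF //; lra.
have q_half : 2^-1 <= q by apply: ger1_powR => //; rewrite invf_le1.
have q1 : q < 1.
  rewrite ltNge; apply/negP => q1; have := le1r_powR q1 p1; rewrite qp; lra.
have e_lt k : `|x k - xs| <= 2 * rho * 2^-1.
  have [xk _] := x_near k; move: xk; rewrite -ball_normE /= distrC; lra.
have rho20 : 0 < 2 * rho by lra.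
exists (2 * rho), q; split; rewrite ?q0 //.
suff H k : `|x k - xs| <= 2 * rho * q `^ (p ^+ k) /\
           `|x k.+1 - xs| <= 2 * rho * q `^ (p ^+ k.+1) by move=> k; case: (H k).
elim: k => [|k [IHk IHk1]].
  rewrite expr0 expr1 qp powRr1 ?(ltW q0) //; split; last exact: e_lt.
  by rewrite (le_trans (e_lt 0)) // ler_pM2l.
split=> //.
have [xk xk1] := x_near k; have [_ /(_ _ (x_run k)) le] := newton_step xk1 xk.
rewrite -(ler_pM2l rho20) (le_trans le) //.
have -> : p ^+ k.+2 = p ^+ k.+1 + p ^+ k.
  by rewrite -addn2 exprD p_sqr mulrDr mulr1 -exprSr.
rewrite powRD ?(gt_eqF q0) ?implybT //.
by rewrite [leRHS](_ : _ = (2 * rho * q `^ (p ^+ k.+1)) * (2 * rho * q `^ (p ^+ k)));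
  [rewrite ler_pM|ring].
Qed.

End NewtonStep.

Theorem corollary4p5 (R : realType) (n : nat) (Omega : set 'rV[R]_n)
    (F : evaluation_procedure Omega) (xstar : 'rV[R]_n)
    (Rbar c gammaF : R) (D := ball xstar Rbar)
    (rho := newton_radius Rbar c gammaF / 3) :
  open Omega ->
  isolated [set x | Omega x /\ evaluate F x = 0] xstar ->
  0 < Rbar ->
  D `<=` Omega ->
  set_bij D (tangent_model F xstar @` D) (tangent_model F xstar) ->
  0 < c ->
  metric_regularity F xstar D c ->
  second_order_constant F D gammaF ->
  (forall x : nat -> 'rV[R]_n,
     ball xstar rho (x 0%N) -> tangent_run F x ->
     (forall k, newton_tangent F (x k) (x k.+1)) /\
     converges_quadratically x xstar) /\
  (forall x : nat -> 'rV[R]_n,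
     ball xstar rho (x 0%N) -> ball xstar rho (x 1%N) -> secant_run F x ->
     (forall k, newton_secant F (x k.+1) (x k) (x k.+2)) /\
     converges_with_order ((1 + Num.sqrt 5) / 2) x xstar).
Proof.
move=> _ /isolatedS[_ root] Rb0 subD bij c0 reg soc; split=> x.
  exact: tangent_newton_converges.
exact: secant_newton_converges.
Qed.
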